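(* For all $w\in\mathcal{SF}(I,\mathbb{R})$, $[w]=w\tilde\Gamma$.
   Context: $I=[0,1]$. $\mathcal{SF}(I,\mathbb{R})$ is the set of $w\in L^2(I,\mathbb{R})$ in standard form, i.e. such that there is a partition $I=A\cup B$ into two disjoint measurable sets with $w=1$ on $A$ and $w=-1$ on $B$. $\tilde\Gamma$ is the set of absolutely continuous $\gamma:I\to I$ with $\gamma(0)=0$, $\gamma(1)=1$, $\gamma'\ge0$ a.e.; $\Gamma\subset\tilde\Gamma$ is the subset (a group under composition) of those with $\gamma'>0$ a.e. They act on the right on $L^2(I,\mathbb{R})$ by $(q*\gamma)(t)=q(\gamma(t))\sqrt{\gamma'(t)}$ (equal to $0$ where $\gamma'(t)=0$). $q\Gamma=\{q*\gamma:\gamma\in\Gamma\}$, $q\tilde\Gamma=\{q*\gamma:\gamma\in\tilde\Gamma\}$, and $[q]$ denotes the closure of $q\Gamma$ in $L^2(I,\mathbb{R})$. *)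

(* Defs.v *)
From HB Require Import structures.
From mathcomp Require Import all_boot all_order all_algebra.
From mathcomp Require Import all_classical all_reals all_analysis.
From mathcomp Require Import measurable_realfun.

Set Implicit Arguments.
Unset Strict Implicit.
Unset Printing Implicit Defensive.

Import Order.TTheory GRing.Theory Num.Theory.
Import numFieldNormedType.Exports.

Local Open Scope classical_set_scope.
Local Open Scope ring_scope.

(* Functions on I = [0, 1] are represented by functions R -> R considered only
   up to equality almost everywhere for the restriction of Lebesgue measure to
   I, so that what happens outside I is irrelevant. *)
Definition leb01 (R : realType) : {measure set (measurableTypeR R) -> \bar R} :=
  mrestr (@lebesgue_measure R) (measurable_itv `[0, 1]).

(* Elements are almost-everywhere classes; u : L2_01 R coerces to an arbitrary
   representative R -> R. *)
Definition L2_01 (R : realType) : Type := LspaceType2 (leb01 R).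

Definition L2_fun (R : realType) (u : L2_01 R) : R -> R :=
  fun t => (u : LspaceType2 (leb01 R)) t.
Coercion L2_fun : L2_01 >-> Funclass.

Definition L2_dist (R : realType) (u v : L2_01 R) : R :=
  fine ('N[leb01 R]_2%:E[EFin \o (fun t => u t - v t)%R])%E.

Section L2_metric.
Context (R : realType).
Implicit Types u v : L2_01 R.

HB.instance Definition _ := gen_eqMixin (L2_01 R).
HB.instance Definition _ := gen_choiceMixin (L2_01 R).

Lemma L2_measurable u : measurable_fun [set: R] (u : R -> R).
Proof.
exact: (@measurable_funPT _ _ _ _
  (repr (u : {mfun_ (leb01 R), measurableTypeR R >-> measurableTypeR R}))).
Qed.

Lemma L2_finite u : finite_norm (leb01 R) 2%:E u.
Proof.
exact: (@Lebesgue_finite _ _ _ _ _ _ (u : LspaceType2 (leb01 R))).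
Qed.

Lemma L2_eqP u v : u = v <-> (u : R -> R) = v %[ae leb01 R].
Proof.
split=> [->|uv]; first exact: ae_eq_refl.
case: u v uv => [u [[cu]]] [v [[cv]]] uv.
have uve : u = v.
  rewrite -[u]reprK -[v]reprK; apply/eqmodP/asboolP; exact: uv.
by subst v; congr (LebesgueSpace.Pack (LebesgueSpace.Class (isFinLebesgue.phant_Build _ _))).
Qed.

Let nrm (f : R -> R) := ('N[leb01 R]_2%:E[EFin \o f])%E.

Let nrmD (f g : R -> R) : measurable_fun setT f -> measurable_fun setT g ->
  (nrm (f \+ g)%R <= nrm f + nrm g)%E.
Proof. by move=> mf mg; apply: eminkowski => //; rewrite lee_fin ler1n. Qed.

Let nrmN (f : R -> R) : nrm (\- f) = nrm f.
Proof. exact: (oppe_Lnorm (leb01 R) (EFin \o f)). Qed.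

Let measurableB u v : measurable_fun setT (fun t => u t - v t).
Proof.
by apply: measurable_funD; [|apply: measurable_funN]; exact: L2_measurable.
Qed.

Let nrmB_fin u v : nrm (fun t => u t - v t) \is a fin_num.
Proof.
rewrite ge0_fin_numE ?Lnorm_ge0//.
apply: (@le_lt_trans _ _ (nrm u + nrm (fun t => - v t)%R)%E).
  by apply: nrmD; [|apply: measurable_funN]; exact: L2_measurable.
by rewrite (nrmN v) lte_add_pinfty//; exact: L2_finite.
Qed.

Let L2_distE u v : (L2_dist u v)%:E = nrm (fun t => u t - v t).
Proof. by rewrite fineK// nrmB_fin. Qed.

Let L2_distxx u : L2_dist u u = 0.
Proof.
apply: EFin_inj; rewrite L2_distE /nrm.
rewrite (_ : EFin \o _ = cst 0%E) ?Lnorm0//.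
by apply/funext => t /=; rewrite subrr.
Qed.

Let L2_dist_positivity u v : L2_dist u v = 0 -> u = v.
Proof.
move=> uv0; apply/L2_eqP.
have : nrm (fun t => u t - v t) = 0%E by rewrite -L2_distE uv0.
move/(@Lnorm_eq0_eq0 _ _ _ (leb01 R) (fun t => (u t - v t)%:E)).
have mB : measurable_fun setT (fun t => (u t - v t)%:E).
  by apply/measurable_EFinP; exact: measurableB.
move=> /(_ mB); rewrite lte_fin => /(_ (ltr0n _ 2)).
by apply: filterS => t /= /(_ I) [] /eqP; rewrite subr_eq0 => /eqP.
Qed.

Let L2_dist_sym u v : L2_dist u v = L2_dist v u.
Proof.
apply: EFin_inj; rewrite !L2_distE -nrmN; congr nrm.
by apply/funext => t /=; rewrite opprB.
Qed.

Let L2_dist_triangle v u w : L2_dist u w <= L2_dist u v + L2_dist v w.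
Proof.
rewrite -lee_fin EFinD !L2_distE.
rewrite (_ : (fun t => u t - w t) = (fun t => u t - v t) \+ (fun t => v t - w t)).
  by apply: nrmD; exact: measurableB.
by apply/funext => t /=; rewrite addrA subrK.
Qed.

HB.instance Definition _ := isMetric.Build R (L2_01 R)
  L2_distxx L2_dist_positivity L2_dist_sym L2_dist_triangle.

Lemma L2_closureP (S : set (L2_01 R)) u :
  closure S u <-> forall e : R, 0 < e -> exists2 v, S v & L2_dist u v < e.
Proof.
split=> [Su e e0|Su B /nbhs_ballP[e /= e0 eB]].
  have [v [Sv]] := Su _ (nbhsx_ballx u e e0).
  by rewrite ballEmdist; exists v.
have [v Sv uv] := Su e e0.
by exists v; split => //; apply: eB; rewrite ballEmdist.
Qed.

End L2_metric.

(* Since elements of L2_01 R are classes, w = 1 on A and w = -1 on B are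
   required almost everywhere.  Up to a null set it makes no difference that
   measurable means Borel here. *)
Definition standard_form (R : realType) : set (L2_01 R) :=
  [set w : L2_01 R | exists A B : set (measurableTypeR R),
    [/\ measurable A, measurable B, A `|` B = `[0, 1]%classic & A `&` B = set0] /\
    (\forall t \ae leb01 R, A t -> w t = 1) /\
    (\forall t \ae leb01 R, B t -> w t = -1)].

Definition absolutely_continuous01 (R : realType) (g : R -> R) : Prop :=
  forall e : R, 0 < e -> exists2 d : R, 0 < d &
    forall (n : nat) (a b : 'I_n -> R),
      (forall i, [/\ 0 <= a i, a i <= b i & b i <= 1]) ->
      trivIset [set: 'I_n] (fun i => `]a i, b i[%classic) ->
      \sum_(i < n) (b i - a i) < d ->
      \sum_(i < n) `|g (b i) - g (a i)| < e.

(* Maps I -> I are given by functions R -> R, whose values outside I play no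
   role: derivatives matter only at almost every t of ]0, 1[.  As derive1 is a
   total function, g' >= 0 a.e. is spelled out as: at almost every t, g has a
   derivative and it is nonnegative. *)
Definition Gamma_tilde (R : realType) : set (R -> R) :=
  [set g : R -> R | [/\ {homo g : t / t \in `[0, 1] >-> t \in `[0, 1]},
    absolutely_continuous01 g, g 0 = 0, g 1 = 1 &
    \forall t \ae leb01 R, derivable g t 1 /\ 0 <= derive1 g t]].

Definition Gamma (R : realType) : set (R -> R) :=
  [set g : R -> R | Gamma_tilde g /\ \forall t \ae leb01 R, 0 < derive1 g t].

(* q * g.  Num.sqrt 0 = 0, so this vanishes where g' does.  For g in
   Gamma_tilde R, two representatives of the same class q give functions that
   are equal a.e., because g' = 0 a.e. on the preimage of a null set. *)
Definition reparam (R : realType) (q g : R -> R) : R -> R :=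
  fun t => q (g t) * Num.sqrt (derive1 g t).

(* The set of the q * g for g in G, as classes in L2; q * g is in L2 for every
   g in Gamma_tilde R, by change of variables. *)
Definition reparam_set (R : realType) (q : L2_01 R) (G : set (R -> R)) :
    set (L2_01 R) :=
  [set u | exists2 g, G g & (u : R -> R) = reparam q g %[ae leb01 R]].

(* Closure for the topology of the metric L2_dist (see L2_closureP). *)
Definition orbit_closure (R : realType) (q : L2_01 R) : set (L2_01 R) :=
  closure (reparam_set q (@Gamma R)).

(* Main.v *)
(* An element g of Gamma_tilde is the primitive of the probability density
   k = g', and w * g is determined by k because k vanishes almost everywhere
   on the preimage under g of a null set.  The vanishing, the identity
   g t = int_0^t k and the change of variables int f(g) k = int f all come
   from one fact: an absolutely continuous function whose lower derivative is
   nonnegative almost everywhere is nondecreasing.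

   Let F be the primitive of w = +-1, which is 1-Lipschitz; then
   F (g t) = int_0^t v |v| for v = w * g, and |v|^2 = k.  If v_n = w * g_n
   converges to u in L2, then v_n |v_n| and v_n^2 converge in L1 to u |u| and
   u^2, so the g_n converge uniformly to the primitive g of u^2 and
   F (g t) = int_0^t u |u|; differentiating, u |u| = w(g) g', i.e. u = w * g.

   Conversely w * g is the limit of w * g_c for g_c t = (1 - c) g t + c t, as
   |x - y|^2 <= 2 | x|x| - y|y| | reduces this to the convergence of
   w(g_c) g_c' to w(g) g' in L1, which holds for a Lipschitz function in place
   of w and hence for w by density and change of variables. *)

From HB Require Import structures.
Require Import Defs.
From mathcomp Require Import all_boot all_order all_algebra.
From mathcomp Require Import all_classical all_reals all_analysis.
From mathcomp Require Import measurable_realfun ring lra.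

Set Implicit Arguments.
Unset Strict Implicit.
Unset Printing Implicit Defensive.

Import Order.TTheory GRing.Theory Num.Theory.
Import numFieldNormedType.Exports.

Local Open Scope classical_set_scope.
Local Open Scope ring_scope.

Local Notation mu := lebesgue_measure.

(** * Monotonicity of absolutely continuous functions *)

(** The supremum [s] of the points [x] with [P a x] is itself such a point, by the local hypothesis
    to the left of [s]; the one to the right moves past [s] unless [s = b]. This stands in for a
    covering argument. *)
Lemma interval_induction (R : realType) (P : R -> R -> Prop) (a b : R) :
  a <= b ->
  (forall x y z, a <= x -> x <= y -> y <= z -> z <= b ->
    P x y -> P y z -> P x z) ->
  (forall x, a <= x <= b -> exists2 d, 0 < d &
    forall y, a <= y <= b ->
      (x <= y < x + d -> P x y) /\ (x - d < y <= x -> P y x)) ->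
  P a b.
Proof.
move=> ab Ptr Ploc.
pose S := [set x | a <= x <= b /\ P a x].
have Sa : S a.
  split; first by rewrite lexx.
  have [|d d0 /(_ a)[|+ _]] := Ploc a; rewrite ?lexx//.
  by apply; rewrite ltrDl.
have supS : has_sup S by split; [exists a|exists b => x [/andP[]]].
pose s := sup S.
have as_ : a <= s by apply: ub_le_sup => //; case: supS.
have sb : s <= b by apply: ge_sup => [|x [/andP[]]]; [exists a|].
have [|d d0 Pd] := Ploc s; first by rewrite as_.
have Pas : P a s.
  have [x [/andP[ax xb] Pax] sx] := sup_adherent d0 supS.
  have xs : x <= s.
    by apply: ub_le_sup; [case: supS|split => //; rewrite ax].
  have [|_ Pxs] := Pd x; first by rewrite ax.
  by apply: (Ptr a x s) => //; apply: Pxs; rewrite sx.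
have [sltb|] := ltP s b; last first.
  by move=> bs; have -> : b = s by apply/eqP; rewrite eq_le bs.
pose y := Num.min b (s + d / 2).
have sy : s < y by rewrite lt_min sltb ltrDl divr_gt0.
have yb : y <= b by rewrite ge_min lexx.
have ysd : y < s + d by rewrite gt_min; apply/orP; right; lra.
have Sy : S y.
  split; first by rewrite (le_trans as_ (ltW sy)).
  apply: (Ptr a s y) => //; first exact: ltW.
  have [|+ _] := Pd y; first by rewrite (le_trans as_ (ltW sy)).
  by apply; rewrite (ltW sy).
have : y <= s by apply: ub_le_sup => //; case: supS.
by rewrite leNgt sy.
Qed.

(* Division-free form of: the lower limit at t of the difference quotients of
   f is nonnegative. *)
Definition lower_derive_ge0 (R : realType) (f : R -> R) (t : R) :=
  forall e, 0 < e -> \forall y \near t, - (e * (y - t) ^+ 2) <= (f y - f t) * (y - t).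

#[local] Instance lebesgue_ae_filter (R : realType) :
  Filter (almost_everywhere (@mu R)).
Proof. exact: (ae_filter_ringOfSetsType (@mu R)). Qed.

Lemma ae_neq (R : realType) (a : R) :
  \forall t \ae @mu R, t != a.
Proof.
exists [set a]; split => //; first exact: lebesgue_measure_set1.
by move=> t /= /negP; rewrite negbK => /eqP.
Qed.

Lemma ae_oo_cc (R : realType) (P : R -> Prop) :
  {ae @mu R, forall t, 0 < t < 1 -> P t} ->
  {ae @mu R, forall t, 0 <= t <= 1 -> P t}.
Proof.
apply: filterS3 (ae_neq 0) (ae_neq 1) => t t0 t1 H /andP[t0' t1'].
by apply: H; rewrite !lt_neqAle t0' t1' t1 eq_sym t0.
Qed.

(** Ordered lists of intervals can be concatenated, which the transitivity step of
    [interval_induction] requires. *)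
Lemma ac_seq (R : realType) (f : R -> R) (e : R) : absolutely_continuous01 f ->
  0 < e -> exists2 d, 0 < d & forall s : seq (R * R),
    all (fun p => [&& 0 <= p.1, p.1 <= p.2 & p.2 <= 1]) s ->
    pairwise (fun p q => p.2 <= q.1) s ->
    \sum_(p <- s) (p.2 - p.1) < d -> \sum_(p <- s) `|f p.2 - f p.1| < e.
Proof.
move=> acf e0; have [d d0 H] := acf e e0; exists d => // s sall spw.
rewrite !(big_nth (0, 0)) !big_mkord => sd.
apply: (H _ (fun i : 'I_(size s) => (nth (0, 0) s i).1) (fun i : 'I_(size s) =>
  (nth (0, 0) s i).2)) => //.
  by move=> i; have /allP/(_ _ (mem_nth (0,0) (ltn_ord i)))/and3P[] := sall.
apply/trivIsetP => i j _ _.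
wlog : i j / (i < j)%N => [hw ij|ij _].
  have [ij'|ji|/val_inj ij'] := ltngtP i j; first exact: hw.
    by rewrite setIC; apply: hw => //; rewrite eq_sym.
  by rewrite ij' eqxx in ij.
have /(pairwiseP (0, 0))/(_ i j (ltn_ord i) (ltn_ord j) ij) ijs := spw.
apply/seteqP; split => // z [] /=; rewrite !in_itv/= => /andP[_ z1] /andP[z2 _].
by have := lt_le_trans (lt_trans z2 z1) ijs; rewrite ltxx.
Qed.

(* Cover the exceptional null set by an open U of measure less than the delta
   of absolute continuity, and run interval_induction on: f drops by at most
   e (b - a) between a and b, plus its variation over finitely many disjoint
   intervals of total length at most mu (U `&` ]a, b]). *)
Lemma ac_nondecreasing (R : realType) (f : R -> R) (x y : R) :
  absolutely_continuous01 f ->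
  {ae @mu R, forall t, 0 < t < 1 -> lower_derive_ge0 f t} ->
  0 <= x -> x <= y -> y <= 1 -> f x <= f y.
Proof.
move=> acf aef x0 xy y1.
apply/ler_addgt0Pr => e0 e0_gt0; pose e := e0 / 2.
have e_gt0 : 0 < e by rewrite divr_gt0.
have [d d_gt0 Hd] := ac_seq acf e_gt0.
pose B := ~` [set t : R | 0 <= t <= 1 -> lower_derive_ge0 f t].
have nB : mu.-negligible B by exact: ae_oo_cc aef.
have [U [oU BU muU]] : exists U, [/\ open U, B `<=` U & (mu U < d%:E)%E].
  have [|U [oU BU]] := @outer_measure_open_le R B (d / 2); first by rewrite divr_gt0.
  have /negligible_outer_measure -> := nB.
  rewrite add0e => muU; exists U; split => //.
  by apply: le_lt_trans muU _; rewrite lte_fin; lra.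
have mU : measurable U by exact: open_measurable.
pose P (a b : R) := exists s : seq (R * R),
  [/\ all (fun p => [&& a <= p.1, p.1 <= p.2 & p.2 <= b]) s,
    pairwise (fun p q => p.2 <= q.1) s,
    ((\sum_(p <- s) (p.2 - p.1))%:E <= mu (U `&` `]a, b]))%E &
    f a - f b <= e * (b - a) + \sum_(p <- s) `|f p.2 - f p.1| ].
have [s [sall spw smu fs]] : P x y.
  apply: interval_induction => //.
  - move=> a b c xa ab bc cy [s [sall spw smu fs]] [r [rall rpw rmu fr]].
    exists (s ++ r); split.
    + rewrite all_cat; apply/andP; split.
        apply: sub_all sall => p /and3P[-> ->] /= pb; exact: le_trans bc.
      by apply: sub_all rall => p /and3P[bp -> ->]; rewrite (le_trans ab).
    + rewrite pairwise_cat spw rpw !andbT; apply/allrelP => p q ps qr.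
      have /allP/(_ _ ps)/and3P[_ _ pb] := sall.
      by have /allP/(_ _ qr)/and3P[bq _ _] := rall; exact: le_trans bq.
    + rewrite big_cat/= EFinD.
      have -> : `]a, c]%classic = `]a, b] `|` `]b, c] :> set R.
        by rewrite -itv_bndbnd_setU//= bnd_simp.
      rewrite setIUr measureU//=; first exact: leeD.
      * exact: measurableI.
      * exact: measurableI.
      * apply/seteqP; split => // z [[_ /=]]; rewrite in_itv/= => /andP[_ zb] [_] /=.
        by rewrite in_itv/= ltNge zb.
    + by rewrite big_cat/=; lra.
  - move=> t /andP[xt ty].
    have ntr a b : a <= b -> f a - f b <= e * (b - a) -> P a b.
      by move=> ab H; exists [::]; split => //; rewrite big_nil ?addr0.
    (* Where the lower derivative is nonnegative the empty list works. Elsewhere [t] lies in [U],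
       and one short interval inside [U] accounts for the whole variation. *)
    have [Lt|nLt] := pselect (lower_derive_ge0 f t).
      have /nbhs_ballP[r /= r0 rH] := Lt _ e_gt0; exists r => // z _; split.
        move=> /andP[tz ztr]; apply: ntr => //.
        have := rH z; rewrite /ball/= ltr_distlC.
        have -> : t - r < z < t + r by lra.
        move=> /(_ erefl); have [->|zt] := eqVneq z t; first lra.
        by rewrite expr2 mulrA -mulNr ler_pM2r;
          [lra|rewrite subr_gt0 lt_neqAle eq_sym zt].
      move=> /andP[tz ztr]; apply: ntr => //.
      have := rH z; rewrite /ball/= ltr_distlC.
      have -> : t - r < z < t + r by lra.
      move=> /(_ erefl); have [->|zt] := eqVneq z t; first lra.
      rewrite expr2 mulrA -mulNr ler_nM2r; [lra|rewrite subr_lt0 lt_neqAle zt//].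
    have Ut : U t by apply: BU => /= Q; apply: nLt; apply: Q;
      rewrite (le_trans x0 xt) (le_trans ty y1).
    have /nbhs_ballP[r /= r0 rU] : nbhs t U by exact: open_nbhs_nbhs.
    have bd a b : t - r < a -> a <= b -> b < t + r -> P a b.
      move=> ta ab bt; exists [:: (a, b)]; split => //=.
      + by rewrite !lexx ab.
      + rewrite big_seq1/= (_ : U `&` _ = `]a, b]%classic).
          rewrite lebesgue_measure_itv/= lte_fin.
          by case: ltP => // ba; rewrite lee_fin; lra.
        apply/setIidr => z /=; rewrite in_itv/= => /andP[az zb].
        by apply: rU; rewrite /ball/= ltr_distlC; lra.
      + rewrite big_seq1/= distrC (le_trans (ler_norm _))// lerDr mulr_ge0//; lra.
    by exists r => // z _; split => /andP[? ?]; apply: bd => //; lra.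
have {smu} smu : \sum_(p <- s) (p.2 - p.1) < d.
  rewrite -lte_fin; apply: le_lt_trans smu _; apply: le_lt_trans muU.
  by apply: le_measure; rewrite ?inE//; exact: measurableI.
have sall' : all (fun p => [&& 0 <= p.1, p.1 <= p.2 & p.2 <= 1]) s.
  by apply: sub_all sall => p /and3P[xp -> py];
    rewrite (le_trans x0 xp) (le_trans py y1).
(* The drop is at most [e (y - x) <= e] from the slopes plus [e] from absolute continuity, hence at
   most [e0]. *)
have := Hd s sall' spw smu.
have : e * (y - x) <= e by rewrite -[leRHS]mulr1 ler_pM2l //; lra.
have ee : e0 = e + e by rewrite /e; lra.
rewrite ee; move: fs; clear; clearbody e; lra.
Qed.

(** * Primitives of integrable functions *)

(** Starting at minus infinity makes the primitive a function on the whole line; for integrands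
    supported in I it is the integral from 0. *)
Definition prim (R : realType) (f : R -> R) (x : R) : R :=
  \int[mu]_(t in `]-oo, x]) f t.

Lemma ge0_Rintegral_le_setT d (T : measurableType d) (R : realType)
    (m : {measure set T -> \bar R}) (A : set T) (f : T -> R) :
  measurable A -> m.-integrable setT (EFin \o f) -> (forall t, 0 <= f t) ->
  \int[m]_(t in A) f t <= \int[m]_t f t.
Proof.
move=> mA intf f0; rewrite /Rintegral fine_le//.
- by apply: integrable_fin_num => //; apply: integrableS intf.
- exact: integrable_fin_num.
- apply: ge0_subset_integral => //; first exact: measurable_int intf.
  by move=> t _; rewrite lee_fin.
Qed.

Section prim.
Context (R : realType).
Implicit Types (f g : R -> R) (x y M : R).
Notation integ f := (mu.-integrable [set: R] (EFin \o f)).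

Lemma integrable_setTS (A : set R) f : measurable A -> integ f ->
  mu.-integrable A (EFin \o f).
Proof. by move=> mA; apply: integrableS. Qed.

Lemma prim_itv f x y : integ f -> x <= y ->
  prim f y - prim f x = \int[mu]_(t in `]x, y]) f t.
Proof. by move=> intf xy; rewrite Rintegral_itvB//; exact: integrable_setTS. Qed.

Lemma prim_ae f : integ f ->
  {ae @mu R, forall t : R, is_derive t 1 (prim f) (f t)}.
Proof.
move=> intf; have := @FTC1Ny R f.
have H1 y : mu.-integrable `]-oo, y] (EFin \o f) by exact: integrable_setTS.
have H2 : locally_integrable [set: R] f.
  by apply: open_integrable_locally => //; exact: openT.
move=> /(_ H1 H2); apply: filterS => t [dt <-].
by rewrite derive1E; exact: DeriveDef.
Qed.

Lemma prim_nondecreasing f x y : integ f -> (forall t, 0 <= f t) -> x <= y ->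
  prim f x <= prim f y.
Proof.
by move=> intf f0 xy; rewrite -subr_ge0 prim_itv//; exact: Rintegral_ge0.
Qed.

(** Absolute continuity of the integral of [|f|], applied to the union of the intervals: its measure
    is the sum of the lengths. *)
Lemma prim_ac f : integ f -> absolutely_continuous01 (prim f).
Proof.
move=> intf e e0; have [d [d0 H]] := integral_normr_continuous intf e0.
exists d => // n a b ab tab sd.
pose D := \big[setU/set0]_(i < n) `]a i, b i[%classic.
have mD : measurable D by exact: bigsetU_measurable.
have muD : (mu D < d%:E)%E.
  rewrite (_ : mu D = (\sum_(i < n) (b i - a i))%:E) ?lte_fin//.
  rewrite /D measure_bigsetU_ord//.
    rewrite -sumEFin; apply: eq_bigr => i _;
      rewrite [LHS](lebesgue_measure_itv `]a i, b i[) /= lte_fin.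
    have [_ abi _] := ab i; case: ltP => // ba; congr EFin; lra.
apply: le_lt_trans (H D mD muD).
rewrite -lee_fin /Rintegral fineK; last first.
  apply: integrable_fin_num => //; apply: integrable_setTS => //.
  exact: (integrable_norm intf).
have mf : measurable_fun setT f by apply/measurable_EFinP; exact: measurable_int intf.
rewrite ge0_integral_bigsetU//=; first last.
- apply/measurable_EFinP; apply: measurableT_comp => //.
  exact: measurable_funS mf.
- by apply: sub_trivIset tab.
- exact: index_enum_uniq.
rewrite -sumEFin; apply: lee_sum => i _.
have [_ abi _] := ab i.
rewrite prim_itv// EFin_normr_Rintegral//; last exact: integrable_setTS.
rewrite -integral_itv_bndo_bndc; last by apply/measurable_EFinP;
  exact: measurable_funS mf.
apply: le_trans (le_abse_integral _ _ _) _ => //.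
by apply/measurable_EFinP; exact: measurable_funS mf.
Qed.

Lemma prim_lip f M x y : integ f -> (forall t, `|f t| <= M) ->
  `|prim f x - prim f y| <= M * `|x - y|.
Proof.
move=> intf fM.
wlog yx : x y / y <= x.
  move=> hw; have [|/ltW xy] := leP y x; first exact: hw.
  by rewrite distrC (distrC x); exact: hw.
rewrite prim_itv// (le_trans (le_normr_Rintegral _ _))//; first exact: integrable_setTS.
have -> : M * `|x - y| = \int[mu]_(t in `]y, x]) M.
  rewrite Rintegral_cst// ger0_norm ?subr_ge0//; congr (_ * _).
  rewrite -[LHS]/(fine (x - y)%:E); congr fine; apply/esym.
  rewrite [LHS](lebesgue_measure_itv `]y, x])/= lte_fin.
  by case: ltP => //= xy; rewrite (_ : x - y = 0)//; lra.
apply: le_Rintegral => //.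
  by apply: integrable_setTS => //; exact: (integrable_norm intf).
apply: measurable_bounded_integrable => //.
  apply: (@le_lt_trans _ _ (`|x - y|)%:E); last exact: ltry.
  rewrite [leLHS](lebesgue_measure_itv `]y, x])/= lte_fin; case: ifP => _.
    by rewrite -EFinB lee_fin ler_norm.
  by rewrite lee_fin.
have M0 : 0 <= M := le_trans (normr_ge0 _) (fM 0).
by exists M; split; [exact: num_real|move=> z Mz t _; rewrite (ger0_norm M0);
  exact: ltW].
Qed.

Lemma primB f g x : integ f -> integ g ->
  prim (fun t => f t - g t) x = prim f x - prim g x.
Proof. by move=> intf intg; rewrite /prim RintegralB//; exact: integrable_setTS. Qed.

Lemma le_normr_prim f x : integ f -> `|prim f x| <= \int[mu]_t `|f t|.
Proof.
move=> intf; apply: le_trans (le_normr_Rintegral _ _) _ => //.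
  exact: integrable_setTS.
by apply: ge0_Rintegral_le_setT => //; exact: (integrable_norm intf).
Qed.

End prim.

(** * The fundamental theorem of calculus for absolutely continuous functions *)

Section lower_derivative.
Context (R : realType).
Implicit Types (f g h : R -> R) (t l M : R).

(** Clearing the denominator includes the point [y = t] and puts derivatives in the same shape as
    [lower_derive_ge0]. *)
Lemma is_derive_nearP f t l : is_derive t 1 f l <->
  (forall e, 0 < e -> \forall y \near t, `|f y - f t - l * (y - t)| <= e * `|y - t|).
Proof.
have key : (h^-1 *: ((f \o shift t) h%:A - f t) @[h --> (0:R)^'] --> l) <->
  (forall e, 0 < e -> \forall y \near t, `|f y - f t - l * (y - t)| <= e * `|y - t|).
  split=> [/cvgrPdist_le H e e0|H].
    have /nbhs_ballP[d /= d0 dH] := H e e0.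
    apply/nbhs_ballP; exists d => //= y; rewrite /ball/= => ty.
    have [->|yt] := eqVneq y t; first by rewrite !subrr mulr0 subr0 normr0 mulr0.
    have yt0 : y - t != 0 by rewrite subr_eq0.
    have := dH (y - t); rewrite /ball/= sub0r normrN distrC => /(_ ty yt0).
    rewrite /GRing.scale/= mulr1 subrK -[X in X <= _ -> _]mulr1.
    rewrite -{1}(@divff _ `|y - t|) ?normr_eq0// mulrA -normrM ler_pdivrMr ?normr_gt0//.
    by rewrite (distrC t y) mulrBl mulrAC mulVf// mul1r (distrC (l * _)).
  apply/(@cvgrPdist_le _ R^o) => e e0; have /nbhs_ballP[d /= d0 dH] := H e e0.
  apply/nbhs_ballP; exists d => //= y; rewrite /ball/= sub0r normrN => yd y0.
  have := dH (y + t); rewrite /ball/= distrC addrK => /(_ yd).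
  move=> dHy; rewrite /GRing.scale/= mulr1 -(@ler_pM2r _ `|y|) ?normr_gt0// -normrM.
  by rewrite mulrBl mulrAC mulVf// mul1r (distrC (l * _)).
split=> [[df dl]|/key H].
  by apply/key; rewrite -dl; move: df => /cvg_ex[k Hk]; rewrite /derive (cvg_lim _ Hk).
by apply: DeriveDef; [apply/cvg_ex; exists l|exact/cvg_lim].
Qed.

Lemma lower_derive_ge0_is_derive f t l : is_derive t 1 f l -> 0 <= l ->
  lower_derive_ge0 f t.
Proof.
move=> /is_derive_nearP df l0 e e0; have := df e e0; apply: filterS => y.
move: (y - t) (f y - f t) => d D.
have [d0|d0] := ger0P d; rewrite ler_norml => /andP[H1 H2].
  have := mulr_ge0 l0 (sqr_ge0 d).
  have : 0 <= (D - l * d + e * d) * d by rewrite mulr_ge0//; lra.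
  lra.
have := mulr_ge0 l0 (sqr_ge0 d).
have : 0 <= (- (D - l * d + e * d)) * - d by rewrite mulr_ge0//; lra.
lra.
Qed.

Lemma lower_derive_ge0D f g t : lower_derive_ge0 f t -> lower_derive_ge0 g t ->
  lower_derive_ge0 (fun x => f x + g x) t.
Proof.
move=> Hf Hg e e0; have e20 : 0 < e / 2 by rewrite divr_gt0.
by apply: filterS2 (Hf _ e20) (Hg _ e20) => y; lra.
Qed.

(** Serves two purposes: composition with a Lipschitz map, and, with [M = 1], passage between
    functions that agree on I. *)
Lemma ac_lip M g h : absolutely_continuous01 g ->
  (forall x y, 0 <= x <= 1 -> 0 <= y <= 1 -> `|h y - h x| <= M * `|g y - g x|) ->
  absolutely_continuous01 h.
Proof.
move=> acg hM e e0; pose N := Num.max M 1.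
have N0 : 0 < N by rewrite lt_max ltr01 orbT.
(* Dividing by [N], the maximum of [M] and 1, keeps the quotient positive whatever [M] is. *)
have [d d0 H] := acg (e / N) (divr_gt0 e0 N0).
exists d => // n a b ab tab sd.
have := H n a b ab tab sd; rewrite ltr_pdivlMr// mulr_suml; apply: le_lt_trans.
apply: ler_sum => i _; have [a0 abi b1] := ab i.
apply: le_trans (hM _ _ _ _) _; rewrite ?a0 ?b1 ?(le_trans abi) ?(le_trans a0)//.
by rewrite mulrC ler_wpM2l// le_max lexx.
Qed.

Lemma acD g h : absolutely_continuous01 g -> absolutely_continuous01 h ->
  absolutely_continuous01 (fun x => g x + h x).
Proof.
move=> acg ach e e0; have e20 : 0 < e / 2 by rewrite divr_gt0.
have [d d0 Hd] := acg _ e20; have [d' d'0 Hd'] := ach _ e20.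
exists (Num.min d d'); first by rewrite lt_min d0.
move=> n a b ab tab; rewrite lt_min => /andP[sd sd'].
rewrite (splitr e); apply: le_lt_trans (ltrD (Hd n a b ab tab sd) (Hd' n a b ab tab
  sd')).
rewrite -big_split/=; apply: ler_sum => i _.
by rewrite opprD addrACA ler_normD.
Qed.

Lemma acN g : absolutely_continuous01 g -> absolutely_continuous01 (fun x => - g x).
Proof.
move=> acg; apply: (@ac_lip 1 g) => // x y _ _.
by rewrite mul1r -opprD normrN.
Qed.

Lemma acB g h : absolutely_continuous01 g -> absolutely_continuous01 h ->
  absolutely_continuous01 (fun x => g x - h x).
Proof. by move=> acg ach; apply: acD => //; exact: acN. Qed.

(** The difference of [h] and [prim p] has derivative 0 almost everywhere, so it and its opposite
    are both nondecreasing. *)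
Lemma ac_ftc h p x y : absolutely_continuous01 h ->
  mu.-integrable [set: R] (EFin \o p) ->
  {ae @mu R, forall t, 0 < t < 1 -> is_derive t 1 h (p t)} ->
  0 <= x -> x <= y -> y <= 1 -> h y - h x = prim p y - prim p x.
Proof.
move=> ach intp dh x0 xy y1.
have dp := prim_ae intp; have acp := prim_ac intp.
have H1 : h x - prim p x <= h y - prim p y.
  apply: (@ac_nondecreasing _ (fun z => h z - prim p z)) => //; first exact: acB.
  apply: filterS2 dh dp => t ht pt t01; have {}ht := ht t01.
  by apply: (@lower_derive_ge0_is_derive _ _ (p t - p t)); rewrite subrr.
have H2 : prim p x - h x <= prim p y - h y.
  apply: (@ac_nondecreasing _ (fun z => prim p z - h z)) => //; first exact: acB.
  apply: filterS2 dh dp => t ht pt t01; have {}ht := ht t01.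
  by apply: (@lower_derive_ge0_is_derive _ _ (p t - p t)); rewrite subrr.
lra.
Qed.

End lower_derivative.

(** * Reparametrizations as primitives of probability densities *)

(** Monotone convergence along truncations; it makes a derivative integrable once the integrals of
    its truncations are uniformly bounded. *)
Lemma integral_truncation_le d (T : measurableType d) (R : realType)
    (m : {measure set T -> \bar R}) (f : T -> R) (C : \bar R) :
  measurable_fun setT f -> (forall t, 0 <= f t) ->
  (forall n : nat, (\int[m]_t (Num.min (f t) n%:R)%:E <= C)%E) ->
  (\int[m]_t (f t)%:E <= C)%E.
Proof.
move=> mf f0 H.
have mg n : measurable_fun setT (fun t => (Num.min (f t) n%:R)%:E).
  by apply/measurable_EFinP; apply: measurable_minr.
have g0 n t : setT t -> (0 <= (Num.min (f t) n%:R)%:E)%E.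
  by move=> _; rewrite lee_fin le_min f0 ler0n.
have nd t : setT t -> nondecreasing_seq (fun n : nat => (Num.min (f t) n%:R)%:E).
  by move=> _ i j ij; rewrite lee_fin le_min2// ler_nat.
have := @cvg_monotone_convergence _ _ _ m _ measurableT _ mg g0 nd.
under eq_integral => t _.
  have -> : limn (fun n : nat => (Num.min (f t) n%:R)%:E) = (f t)%:E.
    apply/cvg_lim => //; apply: cvg_near_cst.
    exists (Num.truncn (f t)).+1 => // n /= nt; congr EFin; apply/min_idPl.
    by rewrite ltW// (lt_le_trans (truncnS_gt _))// ler_nat.
  over.
move=> Hcvg; rewrite -(cvg_lim _ Hcvg)//; apply: lime_le.
  by apply/cvg_ex; exists (\int[m]_t (f t)%:E)%E.
exact: nearW.
Qed.

Lemma integrable_bounded_supp d (T : measurableType d) (R : realType)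
    (m : {measure set T -> \bar R}) (A : set T) (f : T -> R) (M : R) :
  measurable A -> (m A < +oo)%E -> measurable_fun setT f ->
  (forall t, `|f t| <= M) -> (forall t, ~ A t -> f t = 0) ->
  m.-integrable setT (EFin \o f).
Proof.
move=> mA Aoo mf fM f0.
have -> : EFin \o f = (EFin \o f) \_ A.
  apply/funext => t; rewrite patchE; case: ifPn => //= /negP.
  by rewrite inE => /f0 ->.
apply/(integrable_mkcond _ mA)/measurable_bounded_integrable => //.
  exact: measurable_funS mf.
exists M; split; first exact: num_real.
by move=> x Mx t _; apply: le_trans (fM t) (ltW Mx).
Qed.

Section density.
Context (R : realType).
Implicit Types (g k : R -> R).
Notation integ f := (mu.-integrable [set: R] (EFin \o f)).

Lemma integ01_bounded (f : R -> R) (M : R) : measurable_fun setT f ->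
  (forall t, `|f t| <= M) -> (forall t, ~~ (0 <= t <= 1) -> f t = 0) -> integ f.
Proof.
move=> mf fM f0.
have m01 : (mu (`[0%R, 1%R]%classic : set R) < +oo)%E.
  by rewrite [ltLHS](lebesgue_measure_itv `[0, 1])/= lte_fin ltr01 -EFinB ltry.
apply: (integrable_bounded_supp _ m01 mf fM) => //.
by move=> t; rewrite /= in_itv/= => /negP; exact: f0.
Qed.

(** Nonnegativity and vanishing off I hold at every point, so that [prim k] is nondecreasing on the
    whole line, equal to 0 before I and to 1 after it. *)
Definition density k := [/\ measurable_fun setT k, (forall t, 0 <= k t),
  (forall t, ~~ (0 <= t <= 1) -> k t = 0), integ k & \int[mu]_t k t = 1].

Lemma ae_leb01 (P : R -> Prop) : (\forall t \ae leb01 R, P t) <->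
  {ae @mu R, forall t, 0 <= t <= 1 -> P t}.
Proof.
split=> [[B [mB B0 PB]]|[B [mB B0 PB]]].
  exists (B `&` `[0, 1]%classic); split => //; first exact: measurableI.
  move=> t /= /not_implyP[t01 Pt]; split; first exact: PB.
  by rewrite /= in_itv/=.
exists (B `|` ~` `[0, 1]%classic); split => //.
- apply: measurableU => //; exact: measurableC.
- rewrite /leb01/= /mrestr setIUl setICl setU0.
  apply/eqP; rewrite eq_le measure_ge0 andbT -B0.
  by apply: le_measure; rewrite ?inE//; exact: measurableI.
- move=> t /= Pt; have [t01|t01] := boolP (0 <= t <= 1); last first.
    by right; rewrite /= in_itv/=; exact/negP.
  by left; apply: PB => /= /(_ t01).
Qed.

Lemma prim_supp_le0 k x : (forall t, ~~ (0 <= t <= 1) -> k t = 0) ->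
  integ k -> x <= 0 -> prim k x = 0.
Proof.
move=> k0 intk x0; rewrite /prim -Rintegral_itv_bndo_bndc; last first.
  exact: integrable_setTS.
rewrite (@eq_Rintegral _ _ _ _ _ (cst 0)) ?Rintegral_cst ?mul0r//.
move=> t; rewrite inE/= in_itv/= => tx; apply: k0.
by rewrite negb_and -ltNge (lt_le_trans tx).
Qed.

Lemma prim_supp_ge1 k x : (forall t, ~~ (0 <= t <= 1) -> k t = 0) ->
  1 <= x -> prim k x = \int[mu]_t k t.
Proof.
move=> k0 x1; rewrite /prim Rintegral_mkcond; apply: eq_Rintegral => t _.
rewrite patchE; case: ifPn => // /negP; rewrite inE/= in_itv/= => /negP;
  rewrite -ltNge => tx.
by rewrite k0// negb_and orbC -ltNge (le_lt_trans x1).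
Qed.

Lemma density_prim01 k : density k -> forall x, 0 <= prim k x <= 1.
Proof.
move=> [mk k0 ks intk k1] x; apply/andP; split; first exact: Rintegral_ge0.
rewrite -k1; exact: ge0_Rintegral_le_setT.
Qed.

Lemma is_derive_near t g h l : {near t, g =1 h} -> is_derive t 1 g l ->
  is_derive t 1 h l.
Proof.
move=> gh /is_derive_nearP H; apply/is_derive_nearP => e e0.
have ght : g t = h t by exact: nbhs_singleton gh.
by apply: filterS2 gh (H e e0) => y <-; rewrite -ght.
Qed.

Lemma near_oo01 (t : R) : 0 < t < 1 -> \forall y \near t, 0 < y < 1.
Proof.
move=> /andP[t0 t1]; near=> y; apply/andP; split; near: y.
  exact: lt_nbhsr.
exact: lt_nbhsl.
Unshelve. all: by end_near. Qed.

Lemma Gamma_tilde_prim g k : density k ->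
  (forall t, 0 <= t <= 1 -> g t = prim k t) -> Gamma_tilde g.
Proof.
move=> dk gk; have [mk k0 ks intk k1] := dk; split.
- move=> t t01; rewrite in_itv/= gk; last by rewrite in_itv/= in t01.
  exact: density_prim01.
- apply: (@ac_lip _ 1 (prim k)); first exact: prim_ac.
  by move=> x y x01 y01; rewrite !gk// mul1r.
- by rewrite gk ?lexx ?ler01// prim_supp_le0.
- by rewrite gk ?lexx ?ler01// prim_supp_ge1.
- apply/ae_leb01/ae_oo_cc; apply: filterS (prim_ae intk) => t dt t01.
  have /(@is_derive_near _ _ g) : {near t, prim k =1 g}.
    by apply: filterS (near_oo01 t01) => y /andP[y0 y1]; rewrite gk// !ltW.
  by move=> /(_ _ dt) dg; rewrite derive1E derive_val; split.
Qed.

Lemma ac_unif g e : absolutely_continuous01 g -> 0 < e -> exists2 d, 0 < d &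
  forall x y, 0 <= x <= 1 -> 0 <= y <= 1 -> `|x - y| < d -> `|g x - g y| < e.
Proof.
move=> acg e0; have [d d0 H] := acg e e0; exists d => //.
suff K x y : 0 <= x <= 1 -> 0 <= y <= 1 -> x <= y -> `|x - y| < d -> `|g x - g y| < e.
  move=> x y x01 y01; have [|/ltW] := leP x y; first exact: K.
  by move=> yx; rewrite distrC (distrC (g x)); exact: K.
move=> /andP[x0 x1] /andP[y0 y1] xy xyd.
have := H 1%N (fun=> x) (fun=> y); rewrite !big_ord1 distrC; apply.
- by [].
- by move=> i j _ _ _; apply/val_inj; rewrite /= !ord1.
- by rewrite -(ger0_norm (_ : 0 <= y - x)) ?subr_ge0// distrC.
Qed.

(** A Borel version of the derivative is the upper limit of difference quotients. Its integrability
    comes from monotonicity of [g] minus the primitives of truncations, and then [ac_ftc] identifies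
    [g] with its primitive. *)
Lemma Gamma_tilde_density g : Gamma_tilde g -> exists k,
  [/\ density k, (forall t, 0 <= t <= 1 -> g t = prim k t) &
    {ae @mu R, forall t : R, 0 < t < 1 -> is_derive t 1 g (k t)}].
Proof.
move=> [g01 acg g0 g1 /ae_leb01 dg].
(* Clamping the argument to I turns [g] into a continuous function on the line, whence the
   measurability of the quotients [q n]. *)
pose c (t : R) := Num.max 0 (Num.min t 1).
have c01 t : 0 <= c t <= 1 by rewrite le_max lexx/= ge_max ler01 ge_min lexx orbT.
have cE t : 0 <= t <= 1 -> c t = t.
  by move=> /andP[t0 t1]; rewrite /c (min_idPl t1) (max_idPr t0).
have cl x y : `|c x - c y| <= `|x - y|.
  rewrite /c /Num.max /Num.min.
  by do ! case: ifP; move=> *; rewrite ler_norml; apply/andP; split;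
    have := ler_norm (x - y); have := ler_norm (y - x); rewrite (distrC y x); lra.
have mgc : measurable_fun setT (g \o c).
  apply: continuous_measurable_fun => x; apply/cvgrPdist_lt => e e0.
  have [d d0 H] := ac_unif acg e0.
  apply/nbhs_ballP; exists d => //= y; rewrite /ball/= => xy.
  by apply: H => //; exact: le_lt_trans (cl _ _) xy.
pose q (n : nat) (t : R) := n.+1%:R * (g (c (t + n.+1%:R^-1)) - g (c t)).
have mq n : measurable_fun setT (q n).
  apply: measurable_funM => //; apply: measurable_funB => //.
  by apply: (measurableT_comp mgc); apply: measurable_funD.
(* The upper limit is measurable everywhere and equals the derivative where there is one; [fine]
   sends infinite values to 0. *)
pose k1 t := fine (limn_esup (fun n => (q n t)%:E)).
have mk1 : measurable_fun setT k1.
  apply: measurableT_comp => //; apply: measurable_fun_limn_esup => n.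
  exact/measurable_EFinP.
pose k := (fun t => Num.max 0 (k1 t)) \_ `[0, 1].
have mk : measurable_fun setT k.
  by apply/(measurable_restrictT _ _).1 => //;
    apply: measurable_funS (measurable_maxr _ mk1).
have k0 t : 0 <= k t by rewrite /k patchE; case: ifP => //; rewrite le_max lexx.
have ks t : ~~ (0 <= t <= 1) -> k t = 0.
  by move=> t01; rewrite /k patchE ifF//; apply/negP; rewrite inE/= in_itv/=;
    exact/negP.
have kE (t l : R) : 0 < t < 1 -> is_derive t 1 g l -> 0 <= l -> k t = l.
  move=> t01 dt l0; have t01' : 0 <= t <= 1 by case/andP: t01 => *; rewrite !ltW.
  rewrite /k patchE mem_set/=; last by rewrite in_itv/=.
  rewrite /k1 (_ : limn_esup _ = l%:E) ?(max_idPr _)//=.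
  suff : (fun n => (q n t)%:E) @ \oo --> l%:E by move=> /cvg_limn_einf_sup[].
  apply/cvg_EFin; first exact: nearW.
  apply/cvgrPdist_le => e e0.
  have /nbhs_ballP[d /= d0 dH] : nbhs t ([set y | 0 < y < 1] `&`
      [set y | `|g y - g t - l * (y - t)| <= e * `|y - t|]).
    by apply: filterI; [exact: near_oo01|exact: (is_derive_nearP _ _ _).1].
  have := near_infty_natSinv_lt (PosNum d0); apply: filterS => n /= nd.
  have n0 : 0 < n.+1%:R^-1 :> R by rewrite invr_gt0.
  have [|/= /andP[y0 y1]] := dH (t + n.+1%:R^-1).
    by rewrite /ball/= opprD addNKr normrN gtr0_norm.
  rewrite /q !cE ?(ltW y0) ?(ltW y1)// (addrAC t) subrr add0r (gtr0_norm n0).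
  rewrite -(ler_pM2l (_ : 0 < n.+1%:R)) ?ltr0n// mulrCA divff// mulr1.
  rewrite -{1}(@gtr0_norm _ n.+1%:R) ?ltr0n// -normrM distrC mulrBr.
  by rewrite (mulrCA _ l) divff ?mulr1.
have dgk : {ae @mu R, forall t : R, 0 < t < 1 -> is_derive t 1 g (k t)}.
  apply: filterS dg => t dt t01; have {dt}[|dt dt0] := dt.
    by case/andP: t01 => *; rewrite !ltW.
  have dt1 : is_derive (t : R) 1 g (derive1 g t) by rewrite derive1E; exact: DeriveDef.
  by rewrite (kE _ _ t01 dt1).
pose kn (n : nat) t := Num.min (k t) n%:R.
have kn0 n t : 0 <= kn n t by rewrite le_min k0 ler0n.
have mkn n : measurable_fun setT (kn n) by exact: measurable_minr.
have knk n t : kn n t <= k t by rewrite ge_min lexx.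
have kns n t : ~~ (0 <= t <= 1) -> kn n t = 0.
  by move=> /ks kt; apply/eqP; rewrite eq_le kn0 andbT -kt knk.
have intkn n : integ (kn n).
  apply: (@integ01_bounded _ n%:R) => // t; last exact: kns.
  by rewrite ger0_norm// ge_min lexx orbT.
have intk : integ k.
  apply/integrableP; split; first exact/measurable_EFinP.
  under eq_integral do rewrite /= ger0_norm//.
  apply: (@le_lt_trans _ _ 1%E); last exact: ltry.
  apply: integral_truncation_le => // n.
  rewrite -[leLHS]fineK; last exact: (integrable_fin_num _ (intkn n)).
  rewrite lee_fin -/(Rintegral _ _ _) -(prim_supp_ge1 (kns n) (lexx _)).
  (* The derivative of this function is [k - kn n >= 0] almost everywhere, so the integral of [kn n]
     is at most [g 1 - g 0 = 1]. *)
  have := @ac_nondecreasing _ (fun t => g t - prim (kn n) t) 0 1.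
  rewrite g0 g1 (prim_supp_le0 (kns n) (intkn n) (lexx _)) subrr subr_ge0.
  apply; rewrite ?lexx ?ler01//; first exact: acB acg (prim_ac (intkn n)).
  apply: filterS2 dgk (prim_ae (intkn n)) => t dt dnt t01.
  have {}dt := dt t01.
  by apply: (@lower_derive_ge0_is_derive _ _ _ (k t - kn n t)); rewrite subr_ge0.
have gk t : 0 <= t <= 1 -> g t = prim k t.
  move=> /andP[t0 t1]; have := ac_ftc acg intk dgk (lexx 0) t0 t1.
  by rewrite g0 (prim_supp_le0 ks intk (lexx _)) !subr0.
exists k; split => //; split => //.
by rewrite -(prim_supp_ge1 ks (lexx _)) -gk// lexx ler01.
Qed.

End density.

(** * Change of variables along a density *)

Section substitution.
Context (R : realType).
Implicit Types (f g k : R -> R).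
Notation integ f := (mu.-integrable [set: R] (EFin \o f)).

Lemma lebesgue_measure_open_cover (N : set R) (e : R) : mu.-negligible N -> 0 < e ->
  exists U : set R, [/\ open U, N `<=` U & (mu U <= e%:E)%E].
Proof.
move=> /negligible_outer_measure N0 e0.
have [U [oU NU muU]] := outer_measure_open_le N e0.
by exists U; split => //; rewrite N0 add0e in muU.
Qed.

Lemma measurable_prim f : integ f -> (forall t, 0 <= f t) -> measurable_fun setT
  (prim f).
Proof.
move=> intf f0; apply: nondecreasing_measurable => //.
by move=> x y xy; exact: prim_nondecreasing.
Qed.

Lemma density_integrable_comp f k M : density k -> measurable_fun setT f ->
  (forall t, `|f t| <= M) -> integ (fun t => f (prim k t) * k t).
Proof.
move=> [mk k0 ks intk k1] mf fM.
have mg := measurable_prim intk k0.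
have intMk : integ (fun t => M * k t).
  by apply: (@integrableZl _ _ _ mu _ measurableT M _ intk).
apply: (le_integrable measurableT _ _ intMk).
  by apply/measurable_EFinP; apply: measurable_funM => //; exact: measurableT_comp mg.
move=> t _ /=; rewrite lee_fin !normrM ler_wpM2r//.
exact: le_trans (fM _) (ler_norm _).
Qed.

(* The density vanishes on the preimage E of a null set: cover the null set by
   an open U of small measure; then mu (U `&` ]-oo, prim k t]) - prim (k \_ E) t
   is nondecreasing in t. *)
Lemma density_null_preimage k (N : set R) : density k -> mu.-negligible N ->
  {ae @mu R, forall t, N (prim k t) -> k t = 0}.
Proof.
move=> dk [A [mA A0 NA]]; have [mk k0 ks intk k1] := dk.
have mg := measurable_prim intk k0.
have nA : mu.-negligible A by apply/negligibleP.
pose E := prim k @^-1` A.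
have mE : measurable E by rewrite -[E]setTI; exact: mg.
pose kE := k \_ E.
have mkE : measurable_fun setT kE.
  by apply/(measurable_restrictT _ _).1 => //; exact: measurable_funS mk.
have kE0 t : 0 <= kE t by rewrite /kE patchE; case: ifP.
have kEk t : kE t <= k t by rewrite /kE patchE; case: ifP.
have intkE : integ kE.
  apply: (le_integrable measurableT _ _ intk); first exact/measurable_EFinP.
  by move=> t _ /=; rewrite lee_fin !ger0_norm.
have kEs t : ~~ (0 <= t <= 1) -> kE t = 0.
  by move=> /ks kt; apply/eqP; rewrite eq_le kE0 andbT -kt.
have intkE0 : \int[mu]_t kE t <= 0.
  apply/ler_addgt0Pr => e e0; rewrite add0r.
  have [U [oU AU muU]] := lebesgue_measure_open_cover nA e0.
  have mU : measurable U by exact: open_measurable.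
  have Uoo : (mu U < +oo)%E by rewrite (le_lt_trans muU)// ltry.
  have intU : integ (\1_U : R -> R).
    by apply/integrableP; split; [exact/measurable_EFinP|];
      under eq_integral do rewrite /= ger0_norm//; rewrite integral_indic// setIT.
  pose G := prim (\1_U : R -> R).
  have U0 t : 0 <= (\1_U t : R) by [].
  have Glip x y : `|G x - G y| <= 1 * `|x - y|.
    by apply: prim_lip => // t; rewrite ger0_norm// indicE; case: (t \in U).
  have Gmono x y : x <= y -> G x <= G y by exact: prim_nondecreasing.
  have GU : forall x, 0 <= G x <= e.
    move=> x; rewrite Rintegral_ge0//=;
      apply: le_trans (ge0_Rintegral_le_setT _ _ _) _ => //.
    rewrite -lee_fin; apply: le_trans muU; rewrite /Rintegral fineK;
      last exact: (integrable_fin_num _ intU).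
    by rewrite integral_indic// setIT.
  (* For [t] in [E], [U] is a neighbourhood of [prim k t], and near that point [G] has slope 1. *)
  have dG t : E t -> is_derive (t : R) 1 (prim k) (k t) -> is_derive t 1 (G \o prim
    k) (k t).
    move=> Et dt; apply/is_derive_nearP => d d0.
    have /nbhs_ballP[r /= r0 rU] : nbhs (prim k t) U.
      by apply: open_nbhs_nbhs; split => //; exact: AU.
    have cont : {for t, continuous (prim k)}.
      by apply: differentiable_continuous; apply/derivable1_diffP; case: dt.
    have /nbhs_ballP[s /= s0 sr] := cont _ (nbhsx_ballx (prim k t) _ r0).
    have Glin x y : ball (prim k t) r x -> ball (prim k t) r y -> x <= y -> G y - G
      x = y - x.
      rewrite /ball/= !ltr_distlC => rx ry xy; rewrite /G prim_itv//.
      rewrite (@eq_Rintegral _ _ _ _ _ (cst 1)).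
        rewrite Rintegral_cst// mul1r -[RHS]/(fine (y - x)%:E); congr fine.
        rewrite [LHS](lebesgue_measure_itv `]x, y])/= lte_fin.
        by case: ltP => //= yx; rewrite (_ : y - x = 0)//; lra.
      move=> z; rewrite inE/= in_itv/= => /andP[xz zy].
      rewrite indicE mem_set//; apply: rU; rewrite /ball/= ltr_distlC; lra.
    have bt : \forall y \near t, ball t s y by exact: nbhsx_ballx.
    have := (is_derive_nearP _ _ _).1 dt d d0;
      apply: (@filterS2 _ (nbhs t) _ _ _ _ _ bt) => y ty.
    suff -> : (G \o prim k) y - (G \o prim k) t = prim k y - prim k t by [].
    have ry := sr _ ty; have rt := ballxx (prim k t) r0.
    have [gy|/ltW gy] /= := leP (prim k t) (prim k y); first exact: Glin.
    by apply: oppr_inj; rewrite !opprB; exact: Glin.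
  (* [D 0 <= D 1] bounds the integral of [kE] by an increment of [G], which is at most [e]. *)
  pose D t := G (prim k t) - prim kE t.
  have : D 0 <= D 1.
    apply: ac_nondecreasing; rewrite ?lexx ?ler01//.
      apply: acB; last exact: prim_ac.
      by apply: (@ac_lip _ 1 (prim k)); [exact: prim_ac|move=> *; exact: Glip].
    apply: filterS2 (prim_ae intk) (prim_ae intkE) => t dt dEt _.
    (* On [E] both terms of [D] have derivative [k t]. Off [E] the first term is nondecreasing and
       the second has derivative 0. *)
    have [Et|Et] := pselect (E t).
      have kEt : kE t = k t by rewrite /kE patchE mem_set.
      have := dG t Et dt => dGt.
      apply: (@lower_derive_ge0_is_derive _ _ _ (k t - kE t)).
      by rewrite kEt subrr.
    have kEt : kE t = 0 by rewrite /kE patchE memNset.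
    apply: lower_derive_ge0D.
      move=> d d0; apply: (@filterE _ (nbhs t)) => y; apply: (@le_trans _ _ 0).
        by rewrite oppr_le0 mulr_ge0 ?sqr_ge0 ?ltW.
      have [ty|/ltW yt] := leP t y.
        apply: mulr_ge0; rewrite subr_ge0; last exact: ty.
        exact: (Gmono _ _ (prim_nondecreasing intk k0 ty)).
      rewrite -mulrNN; apply: mulr_ge0; rewrite opprB subr_ge0; last exact: yt.
      exact: (Gmono _ _ (prim_nondecreasing intk k0 yt)).
    by apply: (@lower_derive_ge0_is_derive _ _ _ (- kE t)); rewrite kEt oppr0.
  rewrite /D (prim_supp_le0 kEs intkE (lexx _)) (prim_supp_ge1 kEs (lexx _)).
  have aux (u v i : R) : u - 0 <= v - i -> 0 <= u -> v <= e -> i <= e by clear; lra.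
  move=> /aux; apply; first by have /andP[] := GU (prim k 0).
  by have /andP[] := GU (prim k 1).
have : ae_eq mu [set: R] (EFin \o kE) (cst 0%E).
  apply/(ae_eq_integral_abs _ _) => //; first exact/measurable_EFinP.
  under eq_integral do rewrite /= ger0_norm//.
  apply/eqP; rewrite eq_le integral_ge0 ?andbT; last by move=> t _; rewrite lee_fin.
  by rewrite -[leLHS]fineK ?lee_fin//; exact: (integrable_fin_num _ intkE).
apply: filterS => t /= /(_ I) [] kEt Nt.
by move: kEt; rewrite /kE patchE mem_set//=; exact: NA.
Qed.

(** The chain rule applies where [prim f] has derivative [f] at [prim k t]. For almost every other
    [t] the density vanishes, and the Lipschitz bound on [prim f] gives derivative 0. *)
Lemma is_derive_prim_comp f k M : density k -> integ f -> (forall t, `|f t| <= M) ->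
  {ae @mu R, forall t : R, is_derive t 1 (prim f \o prim k) (f (prim k t) * k t)}.
Proof.
move=> dk intf fM; have [mk k0 ks intk k1] := dk.
have := density_null_preimage dk (prim_ae intf).
apply: filterS2 (prim_ae intk) => t dt H.
have [df|/H kt0] := pselect (is_derive (prim k t) 1 (prim f) (f (prim k t))).
  exact: is_derive1_comp.
rewrite kt0 mulr0; apply/is_derive_nearP => e e0.
have M0 : 0 <= M := le_trans (normr_ge0 _) (fM 0).
have M1 : 0 < M + 1 by rewrite ltr_pwDr.
have := (is_derive_nearP _ _ _).1 dt (e / (M + 1)) (divr_gt0 e0 M1).
apply: filterS => y; rewrite kt0 !mul0r !subr0 /= => Hy.
apply: le_trans (prim_lip _ _ intf fM) _.
apply: le_trans (ler_wpM2l M0 Hy) _.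
rewrite mulrA ler_wpM2r// mulrCA ler_piMr ?(ltW e0)//.
by rewrite ler_pdivrMr// mul1r lerDl.
Qed.

(** [prim f \o prim k] is absolutely continuous, being a Lipschitz function of [prim k], so its
    almost everywhere derivative determines its increments. *)
Lemma prim_substitution f k M x y : density k -> integ f ->
  (forall t, `|f t| <= M) -> 0 <= x -> x <= y -> y <= 1 ->
  prim f (prim k y) - prim f (prim k x) =
  prim (fun t => f (prim k t) * k t) y - prim (fun t => f (prim k t) * k t) x.
Proof.
move=> dk intf fM x0 xy y1; have [mk k0 ks intk k1] := dk.
apply: (@ac_ftc _ (prim f \o prim k)) => //.
- apply: (@ac_lip _ M (prim k)); first exact: prim_ac.
  by move=> *; exact: prim_lip.
- apply: (@density_integrable_comp _ _ M) => //.
  by apply/measurable_EFinP; exact: measurable_int intf.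
- by apply: filterS (is_derive_prim_comp dk intf fM) => t + _.
Qed.

End substitution.

(** * Square integrable functions on the unit interval *)

Section L2.
Context (R : realType).
Implicit Types (u v : L2_01 R) (h : R -> R).
Notation integ f := (mu.-integrable [set: R] (EFin \o f)).

(** Extension by zero moves integrals for [leb01 R] to Lebesgue integrals over the line, where
    [prim] is defined. *)
Definition res01 h (t : R) : R := if 0 <= t <= 1 then h t else 0.

Lemma res01E h : res01 h = h \_ `[0, 1]%classic.
Proof.
apply/funext => t; rewrite /res01 patchE; congr (if _ then _ else _).
by apply/idP/idP; rewrite inE/= in_itv.
Qed.

Lemma res01_supp h t : ~~ (0 <= t <= 1) -> res01 h t = 0.
Proof. by rewrite /res01 => /negbTE ->. Qed.

Lemma measurable_res01 h : measurable_fun setT h -> measurable_fun setT (res01 h).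
Proof.
move=> mh; rewrite res01E; apply/(measurable_restrictT _ _).1 => //.
exact: measurable_funS mh.
Qed.

Lemma ge0_integral_leb01 h : measurable_fun setT h -> (forall t, 0 <= h t) ->
  (\int[leb01 R]_x (h x)%:E = \int[mu]_x (res01 h x)%:E)%E.
Proof.
move=> mh h0; have mI : measurable (`[0, 1]%classic : set (measurableTypeR R)) by [].
have mIC : measurable (~` `[0, 1]%classic : set (measurableTypeR R)) by exact:
  measurableC.
transitivity (\int[leb01 R]_(x in `[0%R, 1%R]) (h x)%:E)%E.
  rewrite (ge0_negligible_integral mIC measurableT)//.
  - by rewrite setTD setCK.
  - exact/measurable_EFinP.
  - by move=> t _; rewrite lee_fin.
  - by rewrite /leb01/= /mrestr setICl.
transitivity (\int[mu]_(x in `[0%R, 1%R]) (h x)%:E)%E.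
  by apply: eq_measure_integral => A mA AI; rewrite /leb01/= /mrestr (setIidl AI).
rewrite integral_mkcond/=; apply: eq_integral => t _.
by rewrite res01E !patchE; case: ifP.
Qed.

Lemma Lnorm2_sqr h : measurable_fun setT h ->
  ('N[leb01 R]_2%:E[EFin \o h] `^ 2 = \int[mu]_x ((res01 h x) ^+ 2)%:E)%E.
Proof.
move=> mh; rewrite powR_Lnorm//.
have -> : (fun x => ((res01 h x) ^+ 2)%:E) = (fun x => (res01 (fun t => h t ^+ 2)
  x)%:E).
  by apply/funext => x; rewrite /res01; case: ifP => //; rewrite expr0n.
rewrite -ge0_integral_leb01; first by apply: eq_integral => t _ /=;
  rewrite powR_mulrn// real_normK// num_real.
- by apply: measurable_funX.
- by move=> t; exact: sqr_ge0.
Qed.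

Lemma L2_integ u : integ (fun t => res01 u t ^+ 2).
Proof.
apply/integrableP; split.
  by apply/measurable_EFinP; apply: measurable_funX; apply: measurable_res01;
    exact: L2_measurable.
under eq_integral do rewrite /= ger0_norm ?sqr_ge0//.
rewrite -Lnorm2_sqr; last exact: L2_measurable.
by apply: poweR_lty; exact: L2_finite.
Qed.

Lemma L2_integB u v : integ (fun t => (res01 u t - res01 v t) ^+ 2).
Proof.
have intS : integ (fun t => 2 * (res01 u t ^+ 2) + 2 * (res01 v t ^+ 2)).
  have := integrableD measurableT (integrableZl measurableT 2 (L2_integ u))
    (integrableZl measurableT 2 (L2_integ v)).
  by [].
apply: (le_integrable measurableT _ _ intS).
  apply/measurable_EFinP; apply: measurable_funX.
  by apply: measurable_funB; apply: measurable_res01; exact: L2_measurable.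
move=> t _ /=; rewrite lee_fin.
have ge0 : 0 <= 2 * res01 u t ^+ 2 + 2 * res01 v t ^+ 2.
  by rewrite addr_ge0// mulr_ge0// sqr_ge0.
rewrite (ger0_norm ge0) (ger0_norm (sqr_ge0 _)).
have := sqr_ge0 (res01 u t + res01 v t); lra.
Qed.

Lemma L2_dist_sqr u v : L2_dist u v ^+ 2 = \int[mu]_t ((res01 u t - res01 v t) ^+ 2).
Proof.
have mB : measurable_fun setT (fun t => u t - v t).
  by apply: measurable_funB; exact: L2_measurable.
rewrite /L2_dist /Rintegral.
have -> : (fun x => ((res01 u x - res01 v x) ^+ 2)%:E) = (fun x => ((res01 (fun t
  => u t - v t) x) ^+ 2)%:E).
  by apply/funext => x; rewrite /res01; case: ifP => //; rewrite subrr.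
rewrite -Lnorm2_sqr//.
have := Lnorm_ge0 (leb01 R) 2%:E (EFin \o (fun t => u t - v t)).
case: ('N[_]_ _[_])%E => //= [r|]; last by rewrite expr0n /= pnatr_eq0.
by rewrite lee_fin => r0; rewrite powR_mulrn.
Qed.

(** The class of [h] is formed in the quotient of measurable functions. Its representative agrees
    with [h] almost everywhere, which transfers the finite norm. *)
Lemma L2_exists h : measurable_fun setT h -> integ (fun t => res01 h t ^+ 2) ->
  exists v, (v : R -> R) = h %[ae leb01 R].
Proof.
move=> mh inth.
have mh' : @measurable_fun _ _ (measurableTypeR R) (measurableTypeR R) setT h by [].
pose m : {mfun measurableTypeR R >-> measurableTypeR R} :=
  HB.pack (h : measurableTypeR R -> measurableTypeR R)
    (isMeasurableFun.Build _ _ (measurableTypeR R) (measurableTypeR R) h mh').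
pose q : {mfun_ (leb01 R), measurableTypeR R >-> measurableTypeR R} :=
  \pi_({mfun_ (leb01 R), measurableTypeR R >-> measurableTypeR R})%qT m.
have qm : (q : R -> R) = h %[ae leb01 R].
  have : (repr q = m %[mod {mfun_ (leb01 R), measurableTypeR R >-> measurableTypeR
    R}])%qT.
    by rewrite reprK.
  by move=> /eqmodP/asboolP.
have fq : finite_norm (leb01 R) 2%:E q.
  apply: (@lty_poweRy _ _ 2); first by rewrite pnatr_eq0.
  have mq : measurable_fun setT (q : R -> R).
    exact: (@measurable_funPT _ _ _ _ (repr q)).
  rewrite Lnorm2_sqr// (_ : integral _ _ _ = \int[mu]_x (res01 h x ^+ 2)%:E)%E.
    have /integrableP[_] := inth.
    by under eq_integral do rewrite /= ger0_norm ?sqr_ge0//.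
  apply: ae_eq_integral => //.
  - by apply/measurable_EFinP; apply: measurable_funX; exact: measurable_res01.
  - by apply/measurable_EFinP; apply: measurable_funX; exact: measurable_res01.
  move/ae_leb01 : qm; apply: filterS => t qh _.
  by rewrite /res01; case: ifP => // /qh ->.
pose v : LspaceType2 (leb01 R) := HB.pack q (isFinLebesgue.Build _ _ _ _ _ _ q fq).
by exists v.
Qed.

End L2.

(** * L1 estimates for quadratic expressions in L2 functions *)

Section quadratic.
Context (R : realType).
Implicit Types (u v : L2_01 R) (f k s : R -> R).
Notation integ f := (mu.-integrable [set: R] (EFin \o f)).

Lemma measurable_L2_res u : measurable_fun setT (res01 u).
Proof. by apply: measurable_res01; exact: L2_measurable. Qed.

(** The hypothesis on [s] is the estimate shared by [x^2] and [x |x|]; at [y = 0] it gives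
    [|s x| <= 3 x^2]. *)
Lemma L2_quadratic_integ s u : measurable_fun setT s -> s 0 = 0 ->
  (forall x y, `|s x - s y| <= `|x - y| * (2 * `|x| + `|x - y|)) ->
  integ (fun t => s (res01 u t)).
Proof.
move=> ms s0 sq.
have int3 : integ (fun t => 3 * res01 u t ^+ 2).
  exact: (integrableZl measurableT 3 (L2_integ u)).
apply: (le_integrable measurableT _ _ int3).
  by apply/measurable_EFinP; apply: measurableT_comp => //; exact: measurable_L2_res.
move=> t _ /=; rewrite lee_fin.
have n3 : 0 <= 3 * res01 u t ^+ 2 by rewrite mulr_ge0 ?sqr_ge0.
rewrite (ger0_norm n3).
have := sq (res01 u t) 0; rewrite s0 !subr0 => /le_trans; apply.
rewrite -[res01 u t ^+ 2]real_normK ?num_real// expr2; lra.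
Qed.

(** The mixed term is split with weight [d], which bounds the integrand by
    [d u^2 + (1/d + 1) (u - v)^2]; since the squared distance is at most [d^2], everything is of
    order [d]. *)
Lemma L2_quadratic_bound s u v d : measurable_fun setT s -> s 0 = 0 ->
  (forall x y, `|s x - s y| <= `|x - y| * (2 * `|x| + `|x - y|)) ->
  0 < d -> L2_dist u v <= d ->
  \int[mu]_t `|s (res01 u t) - s (res01 v t)| <=
  d * (\int[mu]_t (res01 u t ^+ 2) + 1 + d).
Proof.
move=> ms s0 sq d0 uvd.
have isu := L2_quadratic_integ u ms s0 sq; have isv := L2_quadratic_integ v ms s0 sq.
have int1 : integ (fun t => d * res01 u t ^+ 2).
  exact: (integrableZl measurableT d (L2_integ u)).
have int2 : integ (fun t => (d^-1 + 1) * (res01 u t - res01 v t) ^+ 2).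
  exact: (integrableZl measurableT _ (L2_integB u v)).
apply: (@le_trans _ _ (\int[mu]_t (d * res01 u t ^+ 2 + (d^-1 + 1) * (res01 u t -
  res01 v t) ^+ 2))).
  apply: le_Rintegral => //.
  - exact: (integrable_norm (integrableB measurableT isu isv)).
  - exact: (integrableD measurableT int1 int2).
  move=> t _; apply: le_trans (sq _ _) _.
  rewrite -[X in d * X]real_normK ?num_real// -[X in _ + _ * X]real_normK ?num_real//.
  move: (`|res01 u t|) (`|res01 u t - res01 v t|) => a b.
  (* AM-GM: 2 a b <= d a^2 + b^2 / d *)
  have : 0 <= d^-1 * (d * a - b) ^+ 2 by rewrite mulr_ge0 ?sqr_ge0// invr_ge0 ltW.
  have -> : d^-1 * (d * a - b) ^+ 2 = d * a ^+ 2 + d^-1 * b ^+ 2 - 2 * a * b.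
    by field; rewrite gt_eqF.
  lra.
rewrite RintegralD// RintegralZl//; last exact: L2_integ.
rewrite RintegralZl//; last exact: L2_integB.
rewrite -L2_dist_sqr.
have : (d^-1 + 1) * L2_dist u v ^+ 2 <= (d^-1 + 1) * d ^+ 2.
  have D0 : 0 <= L2_dist u v by rewrite fine_ge0// Lnorm_ge0.
  apply: ler_wpM2l; first by rewrite addr_ge0// invr_ge0 ltW.
  by rewrite ler_pXn2r// nnegrE// ltW.
have -> : (d^-1 + 1) * d ^+ 2 = d + d ^+ 2 by field; rewrite gt_eqF.
lra.
Qed.

Lemma quadratic_sqr (x y : R) : `|x ^+ 2 - y ^+ 2| <= `|x - y| * (2 * `|x| + `|x - y|).
Proof.
rewrite subr_sqr normrM ler_wpM2l//.
have -> : x + y = 2 * x - (x - y) by ring.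
by rewrite (le_trans (ler_normB _ _))// normrM ger0_norm.
Qed.

Lemma quadratic_signed (x y : R) :
  `|x * `|x| - y * `|y| | <= `|x - y| * (2 * `|x| + `|x - y|).
Proof.
have -> : x * `|x| - y * `|y| = (x - y) * `|x| + y * (`|x| - `|y|) by ring.
apply: (le_trans (ler_normD _ _)); rewrite !normrM normr_id.
have H1 : `| `|x| - `|y| | <= `|x - y| by exact: ler_dist_dist.
have H2 : `|y| <= `|x| + `|x - y|.
  by have := ler_normB x (x - y); rewrite opprB addrC subrK.
have H3 : `|y| * `| `|x| - `|y| | <= (`|x| + `|x - y|) * `|x - y|.
  exact: ler_pM.
lra.
Qed.

End quadratic.

(** * Orbit points described by densities *)

Section reparametrization.
Context (R : realType).
Implicit Types (u v w : L2_01 R) (f g k : R -> R).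
Notation integ f := (mu.-integrable [set: R] (EFin \o f)).

(** A version of [w] in standard form with values exactly 1 or -1 at every point of I and 0
    elsewhere, hence bounded and integrable on the line. *)
Definition sign01 (q : R -> R) : R -> R :=
  res01 (fun t => if 0 <= q t then 1 else -1).

Lemma measurable_sign01 w : measurable_fun setT (sign01 w).
Proof.
apply: measurable_res01; apply: measurable_fun_ifT => //.
apply: measurable_fun_ler => //; exact: L2_measurable.
Qed.

Lemma sign01_le1 (q : R -> R) t : `|sign01 q t| <= 1.
Proof.
rewrite /sign01 /res01; case: ifP => _; last by rewrite normr0.
by case: ifP => _; rewrite ?normrN normr1.
Qed.

Lemma sign01_sqr (q : R -> R) t : 0 <= t <= 1 -> sign01 q t ^+ 2 = 1.
Proof.
by move=> t01; rewrite /sign01 /res01 t01; case: ifP => _; rewrite ?sqrrN expr1n.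
Qed.

Lemma integrable_sign01 w : integ (sign01 w).
Proof.
apply: (@integ01_bounded _ _ 1).
- exact: measurable_sign01.
- exact: sign01_le1.
- exact: res01_supp.
Qed.

Lemma standard_form_sign01 w : standard_form w ->
  {ae @mu R, forall t, 0 <= t <= 1 -> w t = sign01 w t}.
Proof.
move=> [A [B [[mA mB AB _] [/ae_leb01 wA /ae_leb01 wB]]]].
apply: filterS2 wA wB => t wA wB t01; have {}wA := wA t01; have {}wB := wB t01.
have : (A `|` B) t by rewrite AB /= in_itv.
rewrite /sign01 /res01 t01 => -[/wA ->|/wB ->]; first by rewrite ler01.
by rewrite oppr_ge0 ler10.
Qed.

Lemma reparam_ae w k g : standard_form w -> density k ->
  (forall t, 0 <= t <= 1 -> g t = prim k t) ->
  {ae @mu R, forall t : R, 0 < t < 1 -> is_derive t 1 g (k t)} ->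
  {ae @mu R, forall t, 0 <= t <= 1 ->
     reparam w g t = sign01 w (prim k t) * Num.sqrt (k t)}.
Proof.
move=> sw dk gk dg.
(* [w] and [sign01 w] differ on a null subset of I, and [k] vanishes almost everywhere on its
   preimage; there both products contain the square root of 0. *)
have nw : {ae @mu R, forall t, ~ (0 <= prim k t <= 1 -> w (prim k t) = sign01 w
  (prim k t)) -> k t = 0}.
  exact: (density_null_preimage dk (standard_form_sign01 sw)).
apply: filterS2 (ae_oo_cc dg) nw => t dt wt t01; have {}dt := dt t01.
rewrite /reparam gk// derive1E derive_val.
have [->|/wt ->] := pselect (0 <= prim k t <= 1 -> w (prim k t) = sign01 w (prim k
  t)) => //.
  exact: density_prim01.
by rewrite sqrtr0 !mulr0.
Qed.

Lemma prim_is_derive_oo g k : density k ->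
  (forall t, 0 <= t <= 1 -> g t = prim k t) ->
  {ae @mu R, forall t : R, 0 < t < 1 -> is_derive t 1 g (k t)}.
Proof.
move=> dk gk; have [_ _ _ intk _] := dk.
apply: filterS (prim_ae intk) => t dt t01.
apply: (is_derive_near _ dt).
by apply: filterS (near_oo01 t01) => y /andP[y0 y1]; rewrite gk// !ltW.
Qed.

(** Eliminates the maps [g]: from here on a point of the orbit is given by a density alone, with
    [g = prim k] on I. *)
Lemma reparam_set_density w u : standard_form w ->
  reparam_set w (@Gamma_tilde R) u <-> exists2 k, density k &
    {ae @mu R, forall t, 0 <= t <= 1 ->
      u t = sign01 w (prim k t) * Num.sqrt (k t)}.
Proof.
move=> sw; split=> [[g /Gamma_tilde_density[k [dk gk dg]] /ae_leb01 ug]|[k dk uk]].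
  exists k => //; apply: filterS2 ug (reparam_ae sw dk gk dg) => t ut rt t01.
  by rewrite ut// rt.
exists (prim k); first exact: (Gamma_tilde_prim dk).
apply/ae_leb01; have dg := prim_is_derive_oo dk (fun _ _ => erefl).
apply: filterS2 uk (reparam_ae sw dk (fun _ _ => erefl) dg) => t ut rt t01 _.
by rewrite ut// rt.
Qed.

Lemma reparam_set_Gamma w u k : standard_form w -> density k ->
  (forall t, 0 <= t <= 1 -> 0 < k t) ->
  {ae @mu R, forall t, 0 <= t <= 1 ->
      u t = sign01 w (prim k t) * Num.sqrt (k t)} ->
  reparam_set w (@Gamma R) u.
Proof.
move=> sw dk k0 uk; have dg := prim_is_derive_oo dk (fun _ _ => erefl).
exists (prim k).
  split; first exact: (Gamma_tilde_prim dk).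
  apply/ae_leb01; apply: filterS (ae_oo_cc dg) => t dt t01.
  by have dt' := dt t01; rewrite derive1E derive_val; exact: k0.
apply/ae_leb01.
apply: filterS2 uk (reparam_ae sw dk (fun _ _ => erefl) dg) => t ut rt t01 _.
by rewrite ut// rt.
Qed.

End reparametrization.

(** * Limits of orbit points are reparametrizations *)

Section closure.
Context (R : realType).
Implicit Types (u v w : L2_01 R) (f g k : R -> R).
Notation integ f := (mu.-integrable [set: R] (EFin \o f)).

Lemma reparam_Gamma_tilde w u : reparam_set w (@Gamma R) u ->
  reparam_set w (@Gamma_tilde R) u.
Proof. by move=> [g [Gg _] ug]; exists g. Qed.

Lemma prim_dist f g x : integ f -> integ g ->
  `|prim f x - prim g x| <= \int[mu]_t `|f t - g t|.
Proof.
move=> intf intg; rewrite -primB//; apply: le_normr_prim.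
exact: (integrableB measurableT intf intg).
Qed.

Lemma ae_eq_Rintegral f g : measurable_fun setT f -> measurable_fun setT g ->
  {ae @mu R, forall t, f t = g t} -> \int[mu]_t f t = \int[mu]_t g t.
Proof.
move=> mf mg fg; congr fine; apply: ae_eq_integral => //.
- exact/measurable_EFinP.
- exact/measurable_EFinP.
- by apply: filterS fg => t -> _.
Qed.

Lemma reparam_sqr w v k : density k ->
  {ae @mu R, forall t, 0 <= t <= 1 ->
      v t = sign01 w (prim k t) * Num.sqrt (k t)} ->
  {ae @mu R, forall t, res01 v t ^+ 2 = k t}.
Proof.
move=> dk; have [_ k0 ks _ _] := dk; apply: filterS => t vt.
rewrite /res01; case: ifPn => [/vt ->|/ks ->]; last by rewrite expr0n.
by rewrite exprMn sign01_sqr ?mul1r ?sqr_sqrtr//; exact: density_prim01.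
Qed.

(** The sign has modulus 1, so the signed square of [v] keeps the sign and replaces the root of [k]
    by [k]: an expression to which [prim_substitution] applies. *)
Lemma reparam_signed w v k : density k ->
  {ae @mu R, forall t, 0 <= t <= 1 ->
      v t = sign01 w (prim k t) * Num.sqrt (k t)} ->
  {ae @mu R, forall t, res01 v t * `|res01 v t| = sign01 w (prim k t) * k t}.
Proof.
move=> dk; have [_ k0 ks _ _] := dk; apply: filterS => t vt.
rewrite /res01; case: ifPn => [/vt ->|/ks ->]; last by rewrite normr0 !mulr0.
have := sign01_sqr w (density_prim01 dk t); move: (sign01 _ _) => s.
move=> /eqP; rewrite -real_normK ?num_real// sqrp_eq1// => /eqP s1.
rewrite normrM s1 mul1r (ger0_norm (sqrtr_ge0 _)) -mulrA -expr2.
by rewrite sqr_sqrtr.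
Qed.

Lemma measurable_quadratic_signed : measurable_fun setT (fun x : R => x * `|x|).
Proof. by apply: measurable_funM => //; exact: measurableT_comp. Qed.

(** The error has the form produced by [L2_quadratic_bound]; taking [d] to be the minimum of 1 and
    [e / (|C| + 1)] makes it at most [e]. *)
Lemma le_eps_eq0 (x C : R) : 0 <= x -> (forall d, 0 < d -> x <= d * (C + d)) -> x = 0.
Proof.
move=> x0 H; apply/eqP; rewrite eq_le x0 andbT.
have C1 : 0 < `|C| + 1 by rewrite ltr_pwDr.
apply/ler_addgt0Pr => e e0; rewrite add0r.
pose d := Num.min 1 (e / (`|C| + 1)).
have d0 : 0 < d by rewrite lt_min ltr01 divr_gt0.
apply: le_trans (H d d0) _.
apply: (@le_trans _ _ (d * (`|C| + 1))).
  by rewrite ler_pM2l// lerD ?ler_norm// ge_min lexx.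
by rewrite -ler_pdivlMr// ge_min lexx orbT.
Qed.

Lemma orbit_closure_sub w u : standard_form w -> orbit_closure w u ->
  reparam_set w (@Gamma_tilde R) u.
Proof.
move=> sw /L2_closureP clu.
pose F := prim (sign01 w).
have intF := integrable_sign01 w.
pose p t := res01 u t * `|res01 u t|.
pose K t := res01 u t ^+ 2.
have mF := measurable_sign01 w.
have ms : measurable_fun setT (fun x : R => x * `|x|) by exact:
  measurable_quadratic_signed.
have msq : measurable_fun setT (fun x : R => x ^+ 2) by exact: measurable_funX.
have intp : integ p.
  by apply: (L2_quadratic_integ u ms); [rewrite mul0r|exact: quadratic_signed].
have intK : integ K := L2_integ u.
pose U := \int[mu]_t K t.
(* The square and the signed square of [u] are close in L1 to those of an orbit point, namely to [k]
   and to the sign times [k]. *)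
have approx d : 0 < d -> exists v k, [/\ density k,
   {ae @mu R, forall t, 0 <= t <= 1 -> v t = sign01 w (prim k t) * Num.sqrt (k t)},
   \int[mu]_t `|K t - k t| <= d * (U + 1 + d) &
   \int[mu]_t `|p t - sign01 w (prim k t) * k t| <= d * (U + 1 + d)].
  move=> d0; have [v /reparam_Gamma_tilde/(reparam_set_density _ sw)[k dk vk] uv]
    := clu d d0.
  have [mk k0 _ intk _] := dk.
  have intsk := density_integrable_comp dk mF (sign01_le1 w).
  exists v, k; split => //.
    have := L2_quadratic_bound msq (expr0n _ _) (@quadratic_sqr R) d0 (ltW uv).
    rewrite -/U => /(le_trans _); apply; rewrite le_eqVlt; apply/orP; left; apply/eqP.
    apply: ae_eq_Rintegral.
    - apply: measurableT_comp => //; apply: measurable_funB => //.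
      by apply: measurable_funX; exact: measurable_L2_res.
    - apply: measurableT_comp => //; apply: measurable_funB;
      apply: measurable_funX; exact: measurable_L2_res.
    - by apply: filterS (reparam_sqr dk vk) => t ->.
  have := L2_quadratic_bound ms (mul0r _) (@quadratic_signed R) d0 (ltW uv).
  rewrite -/U => /(le_trans _); apply; rewrite le_eqVlt; apply/orP; left; apply/eqP.
  have mp : measurable_fun setT p by apply/measurable_EFinP; exact: measurable_int intp.
  apply: ae_eq_Rintegral.
  - apply: measurableT_comp => //; apply: measurable_funB => //.
    by apply/measurable_EFinP; exact: measurable_int intsk.
  - apply: measurableT_comp => //; apply: measurable_funB => //.
    by apply: (measurableT_comp ms); exact: measurable_L2_res.
  - by apply: filterS (reparam_signed dk vk) => t ->.
(* Total mass passes to L1 limits, so the limit [K] is again a density. *)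
have U1 : U = 1.
  apply/eqP; rewrite -subr_eq0 -normr_eq0; apply/eqP.
  apply: (@le_eps_eq0 _ (U + 1)) => // d d0; have [v [k [dk _ H _]]] := approx d d0.
  have [mk k0 _ intk k1] := dk; apply: (le_trans _ H).
  rewrite -[X in U - X]k1 -RintegralB//; apply: le_normr_Rintegral => //.
  exact: (integrableB measurableT intK intk).
have dK : density K.
  split => //.
  - by apply: measurable_funX; exact: measurable_L2_res.
  - by move=> t; exact: sqr_ge0.
  - by move=> t t01; rewrite /K res01_supp// expr0n.
(* Change of variables gives this identity for the approximating densities; both sides pass to the
   limit because [F] is 1-Lipschitz. *)
have FK x : 0 <= x <= 1 -> F (prim K x) = prim p x.
  move=> /andP[x0 x1].
  apply/eqP; rewrite -subr_eq0 -normr_eq0; apply/eqP.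
  apply: (@le_eps_eq0 _ (U + 1)) => // d0 d00.
  (* Two errors are added below, each of the size [approx] gives for half of [d0]. *)
  have d20 : 0 < d0 / 2 by rewrite divr_gt0.
  pose d := d0 / 2.
  have [v [k [dk _ Hk Hp]]] := approx d d20.
  have [mk k0 ks intk _] := dk.
  have intsk := density_integrable_comp dk mF (sign01_le1 w).
  have sub : F (prim k x) = prim (fun t => sign01 w (prim k t) * k t) x.
    have := prim_substitution dk intF (sign01_le1 w) (lexx _) x0 x1.
    rewrite (prim_supp_le0 ks intk (lexx _)) (prim_supp_le0 _ intF (lexx _));
      last exact: res01_supp.
    rewrite (prim_supp_le0 _ intsk (lexx _)); first by rewrite !subr0.
    by move=> t t01; rewrite ks// mulr0.
  have H1 : `|F (prim K x) - F (prim k x)| <= d * (U + 1 + d).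
    apply: le_trans (prim_lip _ _ intF (sign01_le1 w)) _; rewrite mul1r.
    exact: le_trans (prim_dist x intK intk) Hk.
  have H2 := le_trans (prim_dist x intp intsk) Hp.
  rewrite -sub distrC in H2.
  have -> : F (prim K x) - prim p x = (F (prim K x) - F (prim k x)) + (F (prim k x)
    - prim p x).
    by rewrite addrA subrK.
  apply: le_trans (ler_normD _ _) _; apply: le_trans (lerD H1 H2) _.
  rewrite /d; have := sqr_ge0 d0; clear; lra.
apply/(reparam_set_density _ sw); exists K => //.
apply: ae_oo_cc.
(* Differentiating both sides of [FK] identifies [u |u|] with the sign times [u^2]; cancelling [|u|]
   where [u] is nonzero finishes. *)
apply: filterS2 (is_derive_prim_comp dK intF (sign01_le1 w)) (prim_ae intp) => t dF
  dp t01.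
have dF' : is_derive t 1 (prim p) (sign01 w (prim K t) * K t).
  apply: (is_derive_near _ dF).
  apply: filterS (near_oo01 t01) => y /andP[y0 y1] /=.
  by apply: FK; rewrite !ltW.
have : p t = sign01 w (prim K t) * K t by rewrite -[LHS](@derive_val _ _ _ _ _ _ _
  dp) (@derive_val _ _ _ _ _ _ _ dF').
have t01' : 0 <= t <= 1 by case/andP: t01 => *; rewrite !ltW.
rewrite /p /K; have -> : res01 u t = u t by rewrite /res01 t01'.
rewrite sqrtr_sqr; have [->|u0] := eqVneq (u t) 0; first by move=> _;
  rewrite normr0 mulr0.
rewrite -[in X in _ = X]real_normK ?num_real// expr2 mulrA.
by apply: mulIf; rewrite normr_eq0.
Qed.

End closure.

(** * Reparametrizations are limits of orbit points *)

Section approximation.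
Context (R : realType).
Implicit Types (u v w : L2_01 R) (f g k phi : R -> R).
Notation integ f := (mu.-integrable [set: R] (EFin \o f)).

Lemma lipschitz_measurable f (L : R) : (forall x y, `|f x - f y| <= L * `|x - y|) ->
  measurable_fun setT f.
Proof.
move=> fL; apply: continuous_measurable_fun => x; apply/cvgrPdist_lt => e e0.
have L1 : 0 < `|L| + 1 by rewrite ltr_pwDr.
apply/nbhs_ballP; exists (e / (`|L| + 1)); first exact: divr_gt0.
move=> y; rewrite /ball/= ltr_pdivlMr// => xy.
apply: le_lt_trans (fL x y) _; apply: le_lt_trans xy.
by rewrite mulrC ler_wpM2l// (le_trans (ler_norm _))// lerDl.
Qed.

(* Difference quotients of the primitive are Lipschitz, converge almost
   everywhere, and are dominated. *)
Lemma lipschitz_approximation f (e : R) : measurable_fun setT f -> integ f ->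
  (forall t, `|f t| <= 1) -> 0 < e -> exists phi (L : R),
  [/\ 0 <= L, (forall x y, `|phi x - phi y| <= L * `|x - y|),
     (forall x, `|phi x| <= 1) &
     \int[mu]_t res01 (fun t => `|f t - phi t|) t < e].
Proof.
move=> mf intf f1 e0; pose F := prim f.
have Flip x y : `|F x - F y| <= `|x - y| by rewrite -[leRHS]mul1r; exact: prim_lip.
pose phi n (x : R) : R := n.+1%:R * (F (x + n.+1%:R^-1) - F x).
have n0 n : 0 < n.+1%:R :> R by rewrite ltr0n.
have phiL n x y : `|phi n x - phi n y| <= (n.+1%:R * 2) * `|x - y|.
  rewrite /phi -mulrBr normrM (gtr0_norm (n0 n)) -mulrA ler_pM2l//.
  have -> : F (x + n.+1%:R^-1) - F x - (F (y + n.+1%:R^-1) - F y) =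
    (F (x + n.+1%:R^-1) - F (y + n.+1%:R^-1)) - (F x - F y).
    by rewrite !opprB addrACA [RHS]addrACA; congr (_ + _); rewrite addrC.
  apply: le_trans (ler_normB _ _) _.
  have := Flip (x + n.+1%:R^-1) (y + n.+1%:R^-1).
  rewrite opprD addrACA subrr addr0 mulr_natl mulr2n => /lerD; apply.
  exact: Flip.
have phi1 n x : `|phi n x| <= 1.
  rewrite /phi normrM (gtr0_norm (n0 n)) mulrC -ler_pdivlMr// div1r.
  by apply: le_trans (Flip _ _) _; rewrite addrAC subrr add0r ger0_norm// invr_ge0 ltW.
have mphi n : measurable_fun setT (phi n) := lipschitz_measurable (phiL n).
pose h n := res01 (fun t => `|f t - phi n t|).
have mh n : measurable_fun setT (h n).
  by apply: measurable_res01; apply: measurableT_comp => //; exact: measurable_funB.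
have int1 : integ (res01 (cst 2)).
  apply: (@integ01_bounded _ _ 2); first exact: measurable_res01.
    by move=> t; rewrite /res01; case: ifP; rewrite ?normr0// ger0_norm.
  exact: res01_supp.
have h2 n t : `|h n t| <= res01 (cst 2) t.
  rewrite /h /res01; case: ifP => _; last by rewrite normr0.
  rewrite normr_id (le_trans (ler_normB _ _))//.
  by have := f1 t; have := phi1 n t; rewrite /=; lra.
have hcvg : {ae @mu R, forall t, setT t -> (fun n => (h n t)%:E) @ \oo --> (cst 0 t
  : \bar R)}.
  apply: filterS (prim_ae intf) => t dt _.
  apply/cvg_EFin; first exact: nearW.
  apply/cvgrPdist_le => d d0.
  have /nbhs_ballP[r /= r0 rH] := (is_derive_nearP _ _ _).1 dt d d0.
  have := near_infty_natSinv_lt (PosNum r0); apply: filterS => n /= nr.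
  have i0 : 0 < n.+1%:R^-1 :> R by rewrite invr_gt0.
  have := rH (t + n.+1%:R^-1); rewrite /ball/= opprD addNKr normrN (gtr0_norm i0).
  move=> /(_ nr); rewrite (addrAC t) subrr add0r (gtr0_norm i0) => Hn.
  rewrite sub0r normrN /h /res01; case: ifP => _; last by rewrite normr0 ltW.
  rewrite normr_id -(ler_pM2r i0) distrC.
  rewrite -[X in `|_| * X](gtr0_norm i0) -normrM mulrBl /phi mulrAC divff ?gt_eqF//
    mul1r.
  exact: Hn.
have [||_ _] := @dominated_convergence _ _ _ mu setT measurableT
  (fun n t => (h n t)%:E) (cst 0%E) (EFin \o res01 (cst 2)) _ (measurable_cst _)
    hcvg int1.
- by move=> n; apply/measurable_EFinP; exact: mh.
- by apply: aeW => t n _ /=; rewrite lee_fin.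
rewrite integral0 => /fine_cvgP[_] /cvgrPdist_lt /(_ e e0) [n _ /(_ n (leqnn _))] /=.
rewrite sub0r normrN => H; exists (phi n), (n.+1%:R * 2); split => //.
exact: le_lt_trans (ler_norm _) H.
Qed.

(** [prim_substitution] between 0 and 1: both integrands vanish off I, so the increments are full
    integrals. *)
Lemma integral_substitution f k M : density k -> integ f ->
  (forall t, `|f t| <= M) -> (forall t, ~~ (0 <= t <= 1) -> f t = 0) ->
  \int[mu]_t (f (prim k t) * k t) = \int[mu]_t f t.
Proof.
move=> dk intf fM fs; have [mk k0 ks intk k1] := dk.
have mf : measurable_fun setT f by apply/measurable_EFinP; exact: measurable_int intf.
have := prim_substitution dk intf fM (lexx _) ler01 (lexx _).
have s0 t : ~~ (0 <= t <= 1) -> f (prim k t) * k t = 0.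
  by move=> /ks ->; rewrite mulr0.
rewrite (prim_supp_le0 ks intk (lexx _)) (prim_supp_ge1 ks (lexx _)) k1.
rewrite (prim_supp_le0 fs intf (lexx _)) (prim_supp_ge1 fs (lexx _)).
rewrite (prim_supp_le0 s0 (density_integrable_comp dk mf fM) (lexx _)).
by rewrite (prim_supp_ge1 s0 (lexx _)) !subr0 => ->.
Qed.

(** The density of the identity map, later mixed into [k] to make it positive. *)
Lemma density_uniform : density (res01 (cst 1) : R -> R).
Proof.
split.
- exact: measurable_res01.
- by move=> t; rewrite /res01; case: ifP.
- exact: res01_supp.
- apply: (@integ01_bounded _ _ 1); first exact: measurable_res01.
    by move=> t; rewrite /res01; case: ifP; rewrite ?normr0// normr1.
  exact: res01_supp.
- rewrite res01E -Rintegral_mkcond Rintegral_cst//= mul1r -[RHS]/(fine (1%:E)).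
  congr fine; rewrite [LHS](lebesgue_measure_itv `[0, 1])/= lte_fin ltr01.
  by rewrite oppr0 adde0.
Qed.

Lemma density_convex (c : R) k l : 0 <= c <= 1 -> density k -> density l ->
  density (fun t => (1 - c) * k t + c * l t).
Proof.
move=> /andP[c0 c1] [mk k0 ks intk k1] [ml l0 ls intl l1].
have c1' : 0 <= 1 - c by rewrite subr_ge0.
have ik : integ (fun t => (1 - c) * k t) := integrableZl measurableT _ intk.
have il : integ (fun t => c * l t) := integrableZl measurableT _ intl.
split.
- by apply: measurable_funD; apply: measurable_funM.
- by move=> t; rewrite addr_ge0// mulr_ge0.
- by move=> t t01; rewrite ks// ls// !mulr0 addr0.
- exact: (integrableD measurableT ik il).
- by rewrite RintegralD// !RintegralZl// k1 l1 !mulr1 subrK.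
Qed.

(* Moving the density from k to kc costs |f - phi| twice, by change of
   variables, and what the Lipschitz phi sees. *)
Lemma density_perturbation f phi k kc (L c : R) :
  measurable_fun setT f -> (forall t, `|f t| <= 1) ->
  (forall t, ~~ (0 <= t <= 1) -> f t = 0) -> 0 <= L ->
  (forall x y, `|phi x - phi y| <= L * `|x - y|) -> (forall x, `|phi x| <= 1) ->
  density k -> density kc ->
  (forall t, 0 <= t <= 1 -> `|prim k t - prim kc t| <= c) ->
  \int[mu]_t `|f (prim k t) * k t - f (prim kc t) * kc t| <=
  2 * \int[mu]_t res01 (fun t => `|f t - phi t|) t + L * c +
  \int[mu]_t `|k t - kc t|.
Proof.
move=> mf f1 fs L0 phiL phi1 dk dkc kkc.
have mphi := lipschitz_measurable phiL.
pose g := res01 (fun t => `|f t - phi t|).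
have mg : measurable_fun setT g.
  by apply: measurable_res01; apply: measurableT_comp => //; exact: measurable_funB.
have g2 t : `|g t| <= 2.
  rewrite /g /res01; case: ifP => _; last by rewrite normr0.
  rewrite normr_id (le_trans (ler_normB _ _))//.
  by have := f1 t; have := phi1 t; lra.
have gs : forall t, ~~ (0 <= t <= 1) -> g t = 0 by exact: res01_supp.
have intg : integ g := integ01_bounded mg g2 gs.
have [mk k0 ks intk k1] := dk; have [mkc kc0 kcs intkc kc1] := dkc.
have i1 := density_integrable_comp dk mg g2.
have i2 := density_integrable_comp dkc mg g2.
have i3 : integ (fun t => L * c * k t) := integrableZl measurableT _ intk.
have i4 : integ (fun t => `|k t - kc t|) := integrable_norm (integrableB
  measurableT intk intkc).
have i12 := integrableD measurableT i1 i2.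
have i123 := integrableD measurableT i12 i3.
have i1234 := integrableD measurableT i123 i4.
have -> : 2 * \int[mu]_t g t + L * c + \int[mu]_t `|k t - kc t| =
  \int[mu]_t (g (prim k t) * k t + g (prim kc t) * kc t + L * c * k t + `|k t - kc t|).
  rewrite RintegralD// RintegralD// RintegralD// RintegralZl//.
  rewrite (integral_substitution dk intg g2 gs) (integral_substitution dkc intg g2 gs).
  by rewrite k1 mulr1 mulr_natl mulr2n.
apply: le_Rintegral => //.
  have H : integ (fun t => f (prim k t) * k t - f (prim kc t) * kc t).
    exact: (integrableB measurableT (density_integrable_comp dk mf f1)
      (density_integrable_comp dkc mf f1)).
  exact: (integrable_norm H).
move=> t _; have [t01|t01] := boolP (0 <= t <= 1); last first.
  by rewrite ks// kcs// !mulr0 subrr normr0 !addr0.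
rewrite {1}/g {1}/g /res01 !(density_prim01 _ _)//.
have kt := kkc t t01; have pkc := phi1 (prim kc t).
have Lt := phiL (prim k t) (prim kc t).
have {}Lt : `|phi (prim k t) - phi (prim kc t)| <= L * c.
  by apply: le_trans Lt _; rewrite ler_wpM2l.
have := k0 t; have := kc0 t.
move: (f (prim k t)) (f (prim kc t)) (phi (prim k t)) (phi (prim kc t)) (k t) (kc
  t) pkc Lt.
move: (L * c) => Lc; clear => a b x y p q y1 xy q0 p0.
(* The [f - phi] errors keep their own densities as weights, the variation of [phi] is weighted by
   [p], and the change of density is weighted by a value of modulus at most 1. *)
have -> : a * p - b * q = (a - x) * p - (b - y) * q + (x - y) * p + y * (p - q) by ring.
rewrite (le_trans (ler_normD _ _))// lerD//; last first.
  by rewrite normrM ler_piMl.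
rewrite (le_trans (ler_normD _ _))// lerD//; last first.
  by rewrite normrM (ger0_norm p0) ler_wpM2r.
by rewrite (le_trans (ler_normB _ _))// !normrM (ger0_norm p0) (ger0_norm q0).
Qed.

(** For [y <= x], right side minus left side is [(x - y) (x + 3 y)], [(x + y)^2] or
    [- (x - y) (3 x + y)], according to the signs. Thus L1 closeness of signed squares gives L2
    closeness. *)
Lemma sqr_dist_signed (x y : R) : (x - y) ^+ 2 <= 2 * `|x * `|x| - y * `|y| |.
Proof.
wlog yx : x y / y <= x.
  move=> hw; have [|/ltW] := leP y x; first exact: hw.
  by move=> /hw; rewrite -sqrrN opprB distrC.
apply: le_trans (ler_wpM2l _ (ler_norm _)) => //.
have xy0 : 0 <= x - y by rewrite subr_ge0.
have [x0|/ltW x0] := ger0P x; have [y0|/ltW y0] := ger0P y.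
- have := mulr_ge0 xy0 (_ : 0 <= x + 3 * y); lra.
- have := sqr_ge0 (x + y); lra.
- have y_0 : y = 0 by lra.
  have x_0 : x = 0 by lra.
  by rewrite x_0 y_0; lra.
- have := mulr_ge0 xy0 (_ : 0 <= - (3 * x + y)); lra.
Qed.

End approximation.

(** * Perturbation towards the uniform density *)

Section final.
Context (R : realType).
Implicit Types (u v w : L2_01 R) (f g k phi : R -> R).
Notation integ f := (mu.-integrable [set: R] (EFin \o f)).

(** The square of the candidate is at most [k], which is integrable. *)
Lemma reparam_exists w k : density k -> exists v,
  {ae @mu R, forall t, 0 <= t <= 1 ->
      v t = sign01 w (prim k t) * Num.sqrt (k t)}.
Proof.
move=> [mk k0 ks intk _].
pose h t := sign01 w (prim k t) * Num.sqrt (k t).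
have ms := measurable_sign01 w.
have mh : measurable_fun setT h.
  apply: measurable_funM; first exact: (measurableT_comp ms (measurable_prim intk k0)).
  by apply: measurableT_comp => //;
    exact: continuous_measurable_fun (@sqrt_continuous R).
have [|v /ae_leb01 vh] := L2_exists mh.
  apply: (le_integrable measurableT _ _ intk).
    by apply/measurable_EFinP; apply: measurable_funX; exact: measurable_res01.
  move=> t _ /=; rewrite lee_fin (ger0_norm (k0 _)) (ger0_norm (sqr_ge0 _)).
  rewrite /res01; case: ifP => _; last by rewrite expr0n.
  rewrite /h exprMn sqr_sqrtr// ler_piMl//.
  by rewrite -real_normK ?num_real// expr_le1// sign01_le1.
by exists v; apply: filterS vh => t + t01; apply.
Qed.

Lemma L2_dist_le_signed u v : L2_dist u v ^+ 2 <=
  2 * \int[mu]_t `|res01 u t * `|res01 u t| - res01 v t * `|res01 v t| |.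
Proof.
have ms : measurable_fun setT (fun x : R => x * `|x|) by exact:
  measurable_quadratic_signed.
have iu := L2_quadratic_integ u ms (mul0r _) (@quadratic_signed R).
have iv := L2_quadratic_integ v ms (mul0r _) (@quadratic_signed R).
have iuv := integrable_norm (integrableB measurableT iu iv).
have iuv2 := integrableZl measurableT 2 iuv.
rewrite L2_dist_sqr -RintegralZl//; apply: le_Rintegral => //.
- exact: L2_integB.
- by move=> t _; exact: sqr_dist_signed.
Qed.

Lemma reparam_sub_closure w u : standard_form w ->
  reparam_set w (@Gamma_tilde R) u -> orbit_closure w u.
Proof.
move=> sw /(reparam_set_density _ sw)[k dk uk]; apply/L2_closureP => e e0.
have [mk k0 ks intk k1] := dk.
have mF := measurable_sign01 w; have intF := integrable_sign01 w.
have e2 : 0 < e ^+ 2 / 8 by rewrite divr_gt0// exprn_gt0.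
have [phi [L [L0 phiL phi1 phie]]] :=
  lipschitz_approximation mF intF (sign01_le1 w) e2.
have L2 : 0 < L + 2 by rewrite ltr_wpDl.
(* With [E < e^2 / 8] the error of [phi], the squared distance will be at most
   [2 (2 E + 2 L c + 2 c)], which is below [e^2] once [L c + 2 c <= e^2 / 8]. The bound 1/2 keeps
   [1 - c] positive. *)
pose c := Num.min (1 / 2) (e ^+ 2 / 8 / (L + 2)).
have c0 : 0 < c by rewrite lt_min divr_gt0//= divr_gt0.
have c1 : c <= 1 / 2 by rewrite ge_min lexx.
have cL : L * c + 2 * c <= e ^+ 2 / 8.
  by rewrite -mulrDl mulrC -ler_pdivlMr// ge_min lexx orbT.
pose one := res01 (cst 1) : R -> R.
have d1 : density one := density_uniform R.
have [m1 o0 os int1 o1] := d1.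
(* The density of [(1 - c) g t + c t]; it is at least [c] on I, which places the perturbed map in
   [Gamma]. *)
pose kc t := (1 - c) * k t + c * one t.
have dkc : density kc by apply: density_convex => //; lra.
have [mkc kc0 kcs intkc kc1] := dkc.
have kc_gt0 t : 0 <= t <= 1 -> 0 < kc t.
  move=> t01; rewrite /kc ltr_wpDl//; first by rewrite mulr_ge0//; lra.
  by rewrite /one /res01 t01 mulr1.
have [v vk] := reparam_exists w dkc.
exists v; first exact: (reparam_set_Gamma sw dkc kc_gt0 vk).
have kkc t : `|k t - kc t| <= c * (k t + one t).
  have -> : k t - kc t = c * (k t - one t) by rewrite /kc; ring.
  rewrite normrM (gtr0_norm c0) ler_pM2l// (le_trans (ler_normB _ _))//.
  by rewrite !ger0_norm.
have ik1 := integrableD measurableT intk int1.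
have int_kkc : \int[mu]_t `|k t - kc t| <= 2 * c.
  apply: (@le_trans _ _ (\int[mu]_t (c * (k t + one t)))).
    apply: le_Rintegral => //.
    - exact: (integrable_norm (integrableB measurableT intk intkc)).
    - exact: (integrableZl measurableT c ik1).
  by rewrite RintegralZl// RintegralD// k1 o1 mulrC.
have pkc t : 0 <= t <= 1 -> `|prim k t - prim kc t| <= 2 * c.
  by move=> _; apply: le_trans (prim_dist t intk intkc) int_kkc.
have H := density_perturbation mF (sign01_le1 w) (@res01_supp _ _) L0 phiL phi1 dk
  dkc pkc.
have dist2 := L2_dist_le_signed u v.
(* Signed squares turn the distance estimate into the L1 quantity that [density_perturbation]
   controls. *)
have eqI : \int[mu]_t `|res01 u t * `|res01 u t| - res01 v t * `|res01 v t| | =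
  \int[mu]_t `|sign01 w (prim k t) * k t - sign01 w (prim kc t) * kc t|.
  have ms : measurable_fun setT (fun x : R => x * `|x|) by exact:
    measurable_quadratic_signed.
  apply: ae_eq_Rintegral.
  - apply: measurableT_comp => //; apply: measurable_funB.
      by apply: (measurableT_comp ms); exact: measurable_L2_res.
    by apply: (measurableT_comp ms); exact: measurable_L2_res.
  - apply: measurableT_comp => //; apply: measurable_funB.
      by apply/measurable_EFinP;
        exact: measurable_int (density_integrable_comp dk mF (sign01_le1 w)).
    by apply/measurable_EFinP;
      exact: measurable_int (density_integrable_comp dkc mF (sign01_le1 w)).
  - by apply: filterS2 (reparam_signed dk uk) (reparam_signed dkc vk) => t -> ->.
rewrite eqI in dist2.
rewrite -(@ltr_pXn2r _ 2)// ?nnegrE ?(ltW e0)//; last by rewrite fine_ge0// Lnorm_ge0.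
apply: le_lt_trans dist2 _.
move: (\int[mu]_t _) (\int[mu]_t `|k t - kc t|) int_kkc H => I J JC IJ.
move: phie IJ; move: (\int[mu]_t _) => E Ee IJ.
have c20 : 0 <= 2 * c by rewrite mulr_ge0// ltW.
have : L * (2 * c) = 2 * (L * c) by ring.
move: c20 IJ cL JC Ee e2; move: (2 * c) (e ^+ 2) (L * c) (L * (2 * c)).
by clear => c2 e2 b a c20 IJ cL JC Ee e20 ab; lra.
Qed.

End final.

Theorem theorem2 (R : realType) (w : L2_01 R) (hw : standard_form w) :
  orbit_closure w = reparam_set w (@Gamma_tilde R).
Proof.
apply/seteqP; split => u; first exact: orbit_closure_sub.
exact: reparam_sub_closure.
Qed.
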